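(* Let $q=P_\beta$ be a monic real-rooted polynomial of degree $n\ge2$. Convolution by $q$ strictly contracts $d_2$ between every pair of simple root configurations that are distinct modulo translation — i.e. $d_2(\Omega(\alpha,\beta),\Omega(\widetilde\alpha,\beta))<d_2(\alpha,\widetilde\alpha)$ for all strictly increasing $\alpha,\widetilde\alpha\in\mathbb R^n$ with $\alpha^\circ\ne\widetilde\alpha^\circ$ — if and only if $q$ is not a point mass. Equivalently, $q$ not being a point mass is the necessary and sufficient condition for convolution by $q$ to strictly contract the quadratic Wasserstein distance $W_2$ between distinct centered empirical measures of simple degree-$n$ polynomials.
   Context: Finite free additive convolution: for $p(x)=\sum_{k=0}^n(-1)^ka_kx^{n-k}$ and $q(x)=\sum_{k=0}^n(-1)^kb_kx^{n-k}$ with $a_0=b_0=1$, set $(p\boxplus_n q)(x)=\sum_{k=0}^n(-1)^kc_kx^{n-k}$ with $c_k=\sum_{i+j=k}\frac{(n-i)!(n-j)!}{n!(n-k)!}a_ib_j$; it preserves real-rootedness (Walsh). $P_\alpha(x)=\prod_{i=1}^n(x-\alpha_i)$. $\Omega(\alpha,\beta)\in\mathbb R^n$ is the vector of roots of $P_\alpha\boxplus_nP_\beta$ in increasing order. For $r\in\mathbb R^n$: $\bar r=\frac1n\sum_ir_i$ and $r^\circ=r-\bar r\,\mathbf 1_n$, with $\mathbf 1_n$ the all-ones vector. For increasingly ordered $r,\widetilde r$: $d_2(r,\widetilde r)=\|r^\circ-\widetilde r^\circ\|_2$. The centered empirical measure of $r$ (or of $P_r$) is $\mu_r^\circ=\frac1n\sum_i\delta_{r_i-\bar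 r}$; one has $d_2(r,\widetilde r)=\sqrt n\,W_2(\mu_r^\circ,\mu_{\widetilde r}^\circ)$. ''Simple'' means having pairwise distinct (real) roots. A point mass is a polynomial $(x-b)^n$, $b\in\mathbb R$. *)

(* Defs.v *)
From HB Require Import structures.
From mathcomp Require Import all_boot all_order all_algebra.
From mathcomp Require Import all_classical all_reals all_analysis.
Set Implicit Arguments.
Unset Strict Implicit.
Unset Printing Implicit Defensive.
Import Order.TTheory GRing.Theory Num.Theory.
Import numFieldNormedType.Exports.

Local Open Scope classical_set_scope.
Local Open Scope ring_scope.

Section polynomials.
Variables (R : realType) (n : nat).
Implicit Types (p q : {poly R}) (r alpha beta : 'rV[R]_n).

Definition poly_of_roots r : {poly R} := \prod_(i < n) ('X - (r 0 i)%:P).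

(* The a_k of p = \sum_(k <= n) (-1)^k a_k X^(n-k). *)
Definition alt_coef p (k : nat) : R := (-1) ^+ k * p`_(n - k).

Definition finite_free_coef p q (k : nat) : R :=
  \sum_(i < n.+1) \sum_(j < n.+1 | (i + j == k)%N)
    (((n - i)`!)%:R * ((n - j)`!)%:R) / ((n`!)%:R * ((n - k)`!)%:R)
    * alt_coef p i * alt_coef q j.

Definition finite_free_conv p q : {poly R} :=
  \sum_(k < n.+1) ((-1) ^+ k * finite_free_coef p q k) *: 'X^(n - k).

Definition nondecreasing_vec r := forall i j : 'I_n, (i <= j)%N -> r 0 i <= r 0 j.

Definition increasing_vec r := forall i j : 'I_n, (i < j)%N -> r 0 i < r 0 j.

(* The roots of p with multiplicity, in nondecreasing order; this is the
   junk value 0 when p is not monic real-rooted of degree n. *)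
Definition root_vec p : 'rV[R]_n :=
  xget 0 [set r | nondecreasing_vec r /\ p = poly_of_roots r].

Definition Omega alpha beta : 'rV[R]_n :=
  root_vec (finite_free_conv (poly_of_roots alpha) (poly_of_roots beta)).

Definition simple_poly p :=
  exists r, injective (fun i : 'I_n => r 0 i) /\ p = poly_of_roots r.

Definition point_mass p := exists b : R, p = ('X - b%:P) ^+ n.

Definition vec_mean r : R := n%:R^-1 * \sum_(i < n) r 0 i.

Definition centered r : 'rV[R]_n := r - const_mx (vec_mean r).

(* The library norm on 'rV is the sup norm. *)
Definition norm2 r : R := Num.sqrt (\sum_(i < n) r 0 i ^+ 2).

Definition d2 r r' : R := norm2 (centered r - centered r').

End polynomials.

Section empirical_measure.
Local Open Scope ereal_scope.
Variables (R : realType) (n : nat).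

Definition empirical (r : 'rV[R]_n) (A : set (measurableTypeR R)) : \bar R :=
  (n%:R^-1)%:E * \sum_(i < n) \d_(r 0%R i : measurableTypeR R) A.

Variable r : 'rV[R]_n.

Let atom (k : nat) : measurableTypeR R :=
  if insub k is Some i then r 0%R i else 0%R.

Let empiricalE : empirical r =
  mscale ((n%:R^-1)%:nng)%R (msum (fun k => \d_(atom k)) n).
Proof.
apply/funext => A; rewrite /empirical /mscale /msum /=; congr (_ * _).
by apply: eq_bigr => i _; rewrite /atom valK.
Qed.

Let empirical0 : empirical r set0 = 0.
Proof. by rewrite empiricalE measure0. Qed.

Let empirical_ge0 A : 0 <= empirical r A.
Proof. by rewrite empiricalE measure_ge0. Qed.

Let empirical_sigma_additive : semi_sigma_additive (empirical r).
Proof. by rewrite empiricalE; exact: measure_semi_sigma_additive. Qed.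

HB.instance Definition _ := isMeasure.Build _ _ _ (empirical r)
  empirical0 empirical_ge0 empirical_sigma_additive.

Lemma empirical_setT : (0 < n)%N -> empirical r setT = 1.
Proof.
move=> n0; rewrite /empirical (eq_bigr (fun=> 1)); last first.
  by move=> i _; rewrite diracT.
by rewrite sumEFin sumr_const card_ord -EFinM mulVf// pnatr_eq0 -lt0n.
Qed.

End empirical_measure.

Section wasserstein.
Local Open Scope ereal_scope.
Variable R : realType.
Notation bR := (measurableTypeR R).
Implicit Types mu nu : {measure set bR -> \bar R}.

Definition is_coupling mu nu (pi : {measure set (bR * bR) -> \bar R}) :=
  (forall A : set bR, measurable A -> pi (A `*` setT) = mu A) /\
  (forall B : set bR, measurable B -> pi (setT `*` B) = nu B).

Definition W2 mu nu : \bar R :=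
  sqrte (ereal_inf
    [set \int[pi]_z (((z.1 : R) - (z.2 : R)) ^+ 2)%:E | pi in is_coupling mu nu]).

(* Equality of Borel measures; the library measures are total on sets. *)
Definition same_measure mu nu :=
  forall A : set bR, measurable A -> mu A = nu A.

Definition centered_empirical (n : nat) (p : {poly R}) :
    {measure set bR -> \bar R} :=
  empirical (centered (root_vec n p)).

End wasserstein.

(* Main.v *)
(* The permanent expansion of [conv P_alpha P_beta] along one root,
     conv_(n+1) (X - a)p q = 1/(n+1) sum_b (X - a - b) conv_n p q_b,   q_b := q / (X - b),
   together with [conv_(n+1) p q = 1/(n+1) sum_b conv_n p q_b], gives by induction on [n]
   that [conv p q] is simple when [p] is, and that deleting a root of [p] (when [q] is not
   a point mass), or a root of [q], produces a polynomial strictly interlacing [conv p q].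
   Hence [Omega] is strictly increasing in [alpha]; it also commutes with translations and
   preserves sums. As in the Crandall-Tartar lemma, these three facts alone imply that
   [Omega alpha - Omega alpha'] is majorized by [alpha - alpha'], with a strictly smaller
   maximum, whence the strict contraction of [d2]. For [W2] one needs besides that the
   monotone coupling is optimal, and for the converse that convolution with a point mass is
   a translation. *)
Require Import Defs.
From mathcomp Require Import all_boot all_order all_algebra.
From mathcomp Require Import all_classical all_reals all_analysis.
From mathcomp Require Import ring lra zify polyrcf measurable_realfun.
Set Implicit Arguments.
Unset Strict Implicit.
Unset Printing Implicit Defensive.
Import Order.TTheory GRing.Theory Num.Theory.
Local Open Scope ring_scope.

(** * Coefficients of the convolution *)

Section Convolution.
Variable R : realType.
Implicit Types (p q : {poly R}) (s t : seq R) (n m : nat).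

Local Notation conv := (@finite_free_conv R).
Local Notation P s := (\prod_(x <- s) ('X - x%:P)).

(** The two factors play different roles: [alpha] is simple, whereas roots of [q] may coincide. The
    induction therefore carries two statements, one for deleting a root of either factor, and each
    is proved in degree one higher by averaging instances of the other. Strictness comes from the
    averaged family having at least two distinct members. If the average runs over the roots of [p]
    while [q] is a point mass, the companion statement fails; there the averages are a translate of
    [p] plus a multiple of its derivative, and are treated directly.

    Real-rootedness of the convolution results from the same sign changes, so [root_vec] takes its
    intended value on every convolution that occurs.

    The strictly smaller maximum has this origin: if [d] is the largest entry of [alpha - alpha'],
    then [alpha] lies below the translate of [alpha'] by [d] without being equal to it, and
    monotonicity is strict in every coordinate as soon as one entry differs. *)

Definition conv_monomial n i j : {poly R} :=
  if (n <= i + j)%N then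
    ((i`!)%:R * (j`!)%:R / ((n`!)%:R * ((i + j - n)`!)%:R)) *: 'X^(i + j - n)
  else 0.

(** [conv_monomial n i j] is the convolution of ['X^i] and ['X^j] in degree [n]. Both indices are
    reversed so as to count powers from the bottom; the sign of [k = (n - i) + (n - j)] cancels the
    two signs in [alt_coef], and a pair with [i + j < n] matches no [k <= n]. *)
Lemma finite_free_convE n p q :
  conv n p q =
  \sum_(i < n.+1) \sum_(j < n.+1) (p`_i * q`_j) *: conv_monomial n i j.
Proof.
rewrite /finite_free_conv /finite_free_coef.
under eq_bigr => k _.
  rewrite mulr_sumr scaler_suml.
  under eq_bigr => i _ do rewrite mulr_sumr scaler_suml.
  over.
rewrite exchange_big (reindex_inj rev_ord_inj) /=.
apply: eq_bigr => i _.
under eq_bigr => k _ do rewrite big_mkcond /=.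
rewrite exchange_big (reindex_inj rev_ord_inj) /=.
apply: eq_bigr => j _; rewrite -big_mkcond /= /alt_coef /conv_monomial !subSS.
have hi : (i <= n)%N by rewrite -ltnS.
have hj : (j <= n)%N by rewrite -ltnS.
rewrite !subKn//; case: leqP => hij.
  have hk : (n - i + (n - j) < n.+1)%N by lia.
  rewrite (big_pred1 (Ordinal hk)) => [|k]; last by rewrite eq_sym.
  rewrite /= (_ : (n - (n - i + (n - j)) = i + j - n)%N); last by lia.
  rewrite scalerA; congr (_ *: _).
  rewrite exprD.
  have s2 m : (-1) ^+ m * (-1) ^+ m = 1 :> R by rewrite -expr2 sqrr_sign.
  transitivity (((-1) ^+ (n - i) * (-1) ^+ (n - i)) * ((-1) ^+ (n - j) * (-1) ^+ (n - j)) *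
    (i`!%:R * j`!%:R / (n`!%:R * (i + j - n)`!%:R) * p`_i * q`_j)); first by ring.
  by rewrite !s2; ring.
rewrite big_pred0 ?scaler0// => k; apply/negbTE; have := ltn_ord k; lia.
Qed.

Lemma finite_free_convC n p q : conv n p q = conv n q p.
Proof.
rewrite !finite_free_convE exchange_big /=; apply: eq_bigr => i _.
apply: eq_bigr => j _; rewrite mulrC /conv_monomial addnC.
by rewrite [X in X / _]mulrC.
Qed.

Lemma finite_free_convDr n p q1 q2 : conv n p (q1 + q2) = conv n p q1 + conv n p q2.
Proof.
rewrite !finite_free_convE -big_split; apply: eq_bigr => i _ /=.
rewrite -big_split; apply: eq_bigr => j _ /=.
by rewrite coefD mulrDr scalerDl.
Qed.

Lemma finite_free_convZr n p c q : conv n p (c *: q) = c *: conv n p q.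
Proof.
rewrite !finite_free_convE scaler_sumr; apply: eq_bigr => i _ /=.
rewrite scaler_sumr; apply: eq_bigr => j _ /=.
by rewrite coefZ scalerA; congr (_ *: _); ring.
Qed.

Lemma finite_free_convDl n p1 p2 q : conv n (p1 + p2) q = conv n p1 q + conv n p2 q.
Proof. by rewrite !(finite_free_convC _ _ q) finite_free_convDr. Qed.

Lemma finite_free_convZl n p c q : conv n (c *: p) q = c *: conv n p q.
Proof. by rewrite !(finite_free_convC _ _ q) finite_free_convZr. Qed.

Lemma finite_free_conv0r n p : conv n p 0 = 0.
Proof. by rewrite -[X in conv n p X](scale0r 0) finite_free_convZr scale0r. Qed.

Lemma finite_free_conv_sumr n p (I : Type) (r : seq I) (F : I -> {poly R}) :
  conv n p (\sum_(i <- r) F i) = \sum_(i <- r) conv n p (F i).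
Proof.
elim: r => [|i r IH]; first by rewrite !big_nil finite_free_conv0r.
by rewrite !big_cons finite_free_convDr IH.
Qed.

(** On monomials, [(j+1)! / (n+1)!] is [(j+1) / (n+1)] times [j! / n!], and [j + 1] is the factor
    produced by differentiation. *)
Lemma finite_free_conv_deriv n p q : (size p <= n.+1)%N ->
  conv n.+1 p q = n.+1%:R^-1 *: conv n p q^`().
Proof.
move=> sp; rewrite !finite_free_convE big_ord_recr /= addrC big1; last first.
  by move=> j _; rewrite nth_default// mul0r scale0r.
rewrite add0r scaler_sumr; apply: eq_bigr => i _.
rewrite scaler_sumr big_ord_recl /= /conv_monomial addn0 leqNgt ltnS.
have hi : (i <= n)%N by rewrite -ltnS.
rewrite hi /= scaler0 add0r; apply: eq_bigr => j _.
rewrite /bump /= add1n coef_deriv addnS ltnS; case: leqP => hij; last by rewrite !scaler0.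
rewrite subSS !scalerA; congr (_ *: _).
rewrite !factS !natrM -mulr_natr.
have nzf k : k`!%:R != 0 :> R by rewrite pnatr_eq0 -lt0n fact_gt0.
by field; rewrite !nzf addrC natr1 pnatr_eq0.
Qed.

(** The operator applied to [q] in the last term is a normalised polar derivative: it multiplies the
    coefficient of ['X^j] by [1 - j/(n+1)]. On monomials the identity reduces to
    [i + 1 = (i + j - n) + (n + 1 - j)] once the common factorials are removed. *)
Lemma finite_free_conv_mulX n p q : (size p <= n.+1)%N ->
  conv n.+1 ('X * p) q =
  'X * conv n.+1 p q + conv n p (q - n.+1%:R^-1 *: ('X * q^`())).
Proof.
move=> sp; rewrite !finite_free_convE big_ord_recl /= big1 ?add0r; last first.
  by move=> j _; rewrite coefXM mul0r scale0r.
rewrite [X in _ = 'X * X + _]big_ord_recr /= [X in _ * (_ + X)]big1 ?addr0; last first.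
  by move=> j _; rewrite nth_default// mul0r scale0r.
rewrite mulr_sumr -big_split; apply: eq_bigr => i _ /=.
have nzn := pnatr_eq0 R n.+1; have nzf k : k`!%:R != 0 :> R.
  by rewrite pnatr_eq0 -lt0n fact_gt0.
(* The sum may be extended to [j = n + 1], where the weight [1 - (n+1)/(n+1)] vanishes; all three
   sums then have the same range. *)
have -> : \sum_(j < n.+1) (p`_i * (q - n.+1%:R^-1 *: ('X * q^`()))`_j) *:
    conv_monomial n i j = \sum_(j < n.+2) (p`_i * (q`_j * (1 - j%:R / n.+1%:R))) *:
    conv_monomial n i j.
  rewrite [RHS]big_ord_recr /= mulfV ?nzn// subrr !mulr0 scale0r addr0.
  apply: eq_bigr => j _; congr (_ * _ *: _).
  rewrite coefB coefZ coefXM coef_deriv; case: eqP => [->|/eqP].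
    by rewrite mul0r; ring.
  rewrite -lt0n => j0; rewrite prednK// -mulr_natr; ring.
rewrite mulr_sumr -big_split; apply: eq_bigr => j _ /=.
rewrite /bump /= add1n coefXM /=.
have hi : (i <= n)%N by rewrite -ltnS.
have hj : (j <= n.+1)%N by rewrite -ltnS.
rewrite -scalerAr /conv_monomial addSn ltnS; case: (ltngtP n (i + j)%N) => hij.
- rewrite subSS -scalerAr -exprS (_ : (i + j - n.+1).+1 = i + j - n)%N; last by lia.
  rewrite !scalerA -scalerDl; congr (_ *: _).
  rewrite (_ : (i + j - n = (i + j - n.+1).+1)%N); last by lia.
  have h : (i + j - n.+1)%:R = i%:R + j%:R - n.+1%:R :> R by rewrite natrB// natrD.
  rewrite !factS !natrM -![in X in _ / X]natr1 -[X in X * i`!%:R]natr1 h.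
  rewrite -!natr1 in nzn *.
  have h2 : i%:R + j%:R - (n%:R + 1) + 1 != 0 :> R.
    by rewrite (_ : _ + 1 = (i + j - n)%:R) ?pnatr_eq0 -?lt0n ?subn_gt0// natrB ?natrD; [ring|lia].
  move/negbT: nzn => nzn.
  rewrite h -?natr1; field; rewrite ?nzf ?nzn ?h2//. 
- by rewrite mulr0 !scaler0 ?addr0.
- rewrite -hij !subnn !mulr0 !scaler0 !add0r expr0 !scalerA; congr (_ *: _).
  rewrite !factS !natrM fact0.
  have h : i%:R = n%:R - j%:R :> R by rewrite [in RHS](congr1 (fun k => k%:R : R) hij) natrD; ring.
  move: nzn => /negbT; rewrite -!natr1 h => nzn.
  by field; rewrite ?nzf ?nzn.
Qed.

Lemma prod_XsubC_rem b s : b \in s -> P s = ('X - b%:P) * P (rem b s).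
Proof. by move=> bs; rewrite (perm_big _ (perm_to_rem bs)) /= big_cons. Qed.

Lemma deriv_prod_XsubC s :
  (P s)^`() = \sum_(b <- s) P (rem b s).
Proof.
elim: s => [|a s IH]; first by rewrite !big_nil derivC.
rewrite !big_cons derivM IH derivXsubC mul1r /= eqxx; congr (_ + _).
rewrite mulr_sumr; apply: eq_big_seq => b bs.
case: (eqVneq a b) => [->|_]; first by rewrite -prod_XsubC_rem.
by rewrite big_cons.
Qed.

Lemma conv_prod_lower n s t : size t = n ->
  conv n.+1 (P t) (P s) = n.+1%:R^-1 *: \sum_(b <- s) conv n (P t) (P (rem b s)).
Proof.
move=> st; rewrite finite_free_conv_deriv ?size_prod_XsubC ?st//.
by rewrite deriv_prod_XsubC finite_free_conv_sumr.
Qed.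

Lemma conv_prod_cons n a s t : size t = n -> size s = n.+1 ->
  conv n.+1 (P (a :: t)) (P s) =
  n.+1%:R^-1 *: \sum_(b <- s) ('X - (a + b)%:P) * conv n (P t) (P (rem b s)).
Proof.
move=> st ss; rewrite big_cons mulrBl -mulNr -polyCN mul_polyC.
rewrite finite_free_convDl finite_free_convZl.
rewrite finite_free_conv_mulX ?size_prod_XsubC ?st//.
rewrite conv_prod_lower//.
(* Each of the [n + 1] roots [b] gives [q = (X - b) q_b]; summing over [b] turns [(n+1) q - X q']
   into [- sum_b b q_b]. *)
have -> : P s - n.+1%:R^-1 *: ('X * (P s)^`()) =
    n.+1%:R^-1 *: \sum_(b <- s) (- b) *: P (rem b s).
  apply: (@scalerI _ _ n.+1%:R); first by rewrite pnatr_eq0.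
  rewrite scalerBr !scalerA mulfV ?pnatr_eq0// !scale1r deriv_prod_XsubC.
  have -> : n.+1%:R *: P s = \sum_(b <- s) P s.
    by rewrite big_const_seq count_predT iter_addr_0 ss scaler_nat.
  rewrite mulr_sumr -sumrB; apply: eq_big_seq => b bs.
  rewrite (prod_XsubC_rem bs) mulrBl -mul_polyC polyCN.
  by ring.
rewrite finite_free_convZr finite_free_conv_sumr -scalerAr (scalerA (- a)) (mulrC (- a)).
rewrite -scalerA -!scalerDr.
congr (_ *: _); rewrite mulr_sumr scaler_sumr -!big_split /=.
apply: eq_bigr => b _; rewrite finite_free_convZr -!mul_polyC.
by rewrite polyCD polyCN; ring.
Qed.

Lemma finite_free_conv0_1 : conv 0 1 1 = 1.
Proof.
rewrite finite_free_convE !big_ord_recl !big_ord0 !addr0 /conv_monomial /=.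
by rewrite subnn fact0 !mulr1 divr1 expr0 !coefC /= mulr1 !scale1r.
Qed.

End Convolution.

(** * Strict interlacing *)

Section Interlacing.
Variable R : realType.
Implicit Types (p q f : {poly R}) (l r t : nat -> R) (n m k : nat).

(** Roots are sequences on [nat] of which only the first [m] values count, so neighbouring indices
    are reached without casts between ordinals. *)
Definition rootpoly m l : {poly R} := \prod_(i < m) ('X - (l i)%:P).

Definition increasing_upto m l := forall i j, (i < j)%N -> (j < m)%N -> l i < l j.

Definition interlaces m r t := forall i, (i < m)%N -> t i < r i < t i.+1.

Lemma increasing_upto_succ m l :
  (forall i, (i.+1 < m)%N -> l i < l i.+1) -> increasing_upto m l.
Proof.
move=> h i j; elim: j => // j IH; rewrite ltnS leq_eqVlt => /predU1P[->|ij] jm.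
  exact: h.
by apply: (lt_trans (IH ij _) (h _ jm)); exact: ltnW.
Qed.

Lemma increasing_upto_le m l i j : increasing_upto m l ->
  (i <= j)%N -> (j < m)%N -> l i <= l j.
Proof. by move=> h; rewrite leq_eqVlt => /predU1P[->//|ij] jm; exact/ltW/h. Qed.

Lemma interlaces_outer m r t : interlaces m r t -> increasing_upto m.+1 t.
Proof.
move=> h; apply: increasing_upto_succ => i; rewrite ltnS => /h/andP[h1 h2].
exact: lt_trans h2.
Qed.

Lemma size_rootpoly m l : size (rootpoly m l) = m.+1.
Proof. by rewrite size_prod_XsubC /index_enum -enumT size_enum_ord. Qed.

Lemma coef_rootpoly m l : (rootpoly m l)`_m = 1.
Proof.
have /monicP := monic_prod_XsubC (index_enum 'I_m) xpredT l.
by rewrite lead_coefE size_rootpoly.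
Qed.

Lemma rootpoly_mkseq m l : rootpoly m l = \prod_(x <- mkseq l m) ('X - x%:P).
Proof.
by rewrite /rootpoly -(big_mkord xpredT (fun i => 'X - (l i)%:P)) /index_iota subn0 big_map.
Qed.

Lemma horner_rootpolyS m l x : (rootpoly m.+1 l).[x] = (rootpoly m l).[x] * (x - l m).
Proof. by rewrite /rootpoly big_ord_recr /= hornerM hornerXsubC. Qed.

Lemma rootpoly_sign m l k x : (k <= m)%N ->
  (forall i, (i < k)%N -> l i < x) ->
  (forall i, (k <= i)%N -> (i < m)%N -> x < l i) ->
  0 < (-1) ^+ (m - k) * (rootpoly m l).[x].
Proof.
elim: m => [|m IH] in k *.
  by rewrite leqn0 => /eqP-> _ _; rewrite /rootpoly big_ord0 hornerC mulr1.
rewrite leq_eqVlt => /predU1P[->|]; last rewrite ltnS => km; move=> h1 h2.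
  rewrite subnn mul1r horner_rootpolyS mulr_gt0 ?subr_gt0 ?h1//.
  have := IH m (leqnn m); rewrite subnn mul1r; apply.
    by move=> i im; apply: h1; exact: ltnW.
  by move=> i mi im; have := leq_ltn_trans mi im; rewrite ltnn.
rewrite subSn// exprS horner_rootpolyS.
rewrite (_ : _ * _ = (-1) ^+ (m - k) * (rootpoly m l).[x] * (l m - x)); last by ring.
by rewrite mulr_gt0 ?subr_gt0 ?h2// IH// => i ki im; apply: h2 => //; exact: ltnW.
Qed.

Lemma rootpoly_sign_weak m l k x : (k <= m)%N ->
  (forall i, (i < k)%N -> l i <= x) ->
  (forall i, (k <= i)%N -> (i < m)%N -> x <= l i) ->
  0 <= (-1) ^+ (m - k) * (rootpoly m l).[x].
Proof.
move=> km h1 h2; case: (pselect (exists2 i, (i < m)%N & l i = x)).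
  move=> [i im <-]; rewrite /rootpoly horner_prod (bigD1 (Ordinal im))//=.
  by rewrite hornerXsubC subrr mul0r mulr0.
move=> h; apply/ltW/rootpoly_sign => // [i ik|i ki im]; rewrite lt_neqAle.
  rewrite h1// andbT; apply/eqP => e; apply: h; exists i => //.
  exact: leq_trans ik km.
by rewrite h2// andbT; apply/eqP => e; apply: h; exists i.
Qed.

Lemma poly_sign_change f (a b : R) : a < b -> f.[a] * f.[b] < 0 ->
  exists x, a < x < b /\ root f x.
Proof.
move=> ab fab.
wlog fa : f fab / f.[a] < 0.
  move=> H; case: (ltrgtP f.[a] 0) fab => [fa|fa|->]; last by rewrite mul0r ltxx.
    by move=> h; apply: H.
  move=> h; have [||x [xab rx]] := H (- f); rewrite ?hornerN ?mulrNN ?oppr_lt0//.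
  by exists x; split => //; rewrite -rootN.
have fb : 0 < f.[b] by rewrite -(nmulr_rlt0 _ fa).
have [|x /andP[ax xb] rx] := poly_ivt (ltW ab) (p := f); first by rewrite (ltW fa) (ltW fb).
exists x; split => //; rewrite !lt_neqAle ax xb !andbT; apply/andP; split.
  by apply/eqP => e; move: fa; rewrite e (rootP rx) ltxx.
by apply/eqP => e; move: fb; rewrite -e (rootP rx) ltxx.
Qed.

(** One root in each of [m] disjoint open intervals exhausts the degree. Consecutive intervals may
    share an endpoint, because the roots are interior. *)
Lemma rootpoly_of_signs m f (a b : nat -> R) : (size f <= m.+1)%N -> f`_m = 1 ->
  (forall k, (k < m)%N -> a k < b k /\ f.[a k] * f.[b k] < 0) ->
  (forall k, (k.+1 < m)%N -> b k <= a k.+1) ->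
  exists2 r, f = rootpoly m r & forall k, (k < m)%N -> a k < r k < b k.
Proof.
move=> sf cf h1 h2.
have /choice[r rP] : forall k, exists x, (k < m)%N -> a k < x < b k /\ root f x.
  move=> k; case: (ltnP k m) => [km|]; last by exists 0.
  by have [h3 h4] := h1 k km; have [x] := poly_sign_change h3 h4; exists x.
have rinc : increasing_upto m r.
  apply: increasing_upto_succ => i im.
  have [/andP[_ h3] _] := rP i (ltnW im); have [/andP[h4 _] _] := rP _ im.
  exact: lt_trans h3 (le_lt_trans (h2 _ im) h4).
exists r; last by move=> k /rP[].
have szf : size f = m.+1.
  apply/eqP; rewrite eqn_leq sf /= ltnNge; apply/negP.
  by move=> /leq_sizeP/(_ m (leqnn m))/eqP; rewrite cf oner_eq0.
rewrite [LHS](@all_roots_prod_XsubC _ f (mkseq r m)) ?size_mkseq//.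
- by rewrite lead_coefE szf cf scale1r -rootpoly_mkseq.
- by apply/allP => _ /mapP[k + ->]; rewrite mem_iota => /rP[].
- rewrite uniq_rootsE map_inj_in_uniq ?iota_uniq// => i j.
  rewrite !mem_iota /= => im jm e; case: (ltngtP i j) => // ij.
    by have := rinc _ _ ij jm; rewrite e ltxx.
  by have := rinc _ _ ij im; rewrite e ltxx.
Qed.

Lemma sign_change_signr (x y : R) k :
  0 < (-1) ^+ k.+1 * x -> 0 < (-1) ^+ k * y -> x * y < 0.
Proof.
move=> hx hy; rewrite -oppr_gt0.
suff -> : - (x * y) = ((-1) ^+ k.+1 * x) * ((-1) ^+ k * y) by exact: mulr_gt0.
transitivity (- ((-1) ^+ k * (-1) ^+ k * (x * y))); last by rewrite exprS; ring.
by rewrite -expr2 sqrr_sign mul1r.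
Qed.

Lemma poly_pos_above f (b : R) : 0 < lead_coef f -> exists2 x, b < x & 0 < f.[x].
Proof.
move=> f0; have [c hc] := poly_pinfty_gt_lc f0.
exists (Num.max (b + 1) c); first by rewrite lt_max ltrDl ltr01.
by apply: lt_le_trans f0 (hc _ _); rewrite le_max lexx orbT.
Qed.

Lemma poly_sign_below f (b : R) : 0 < lead_coef f ->
  exists2 x, x < b & 0 < (-1) ^+ (size f).-1 * f.[x].
Proof.
move=> f0; pose g := (-1) ^+ (size f).-1 *: (f \Po (- 'X)).
have sX : size (- 'X : {poly R}) = 2 by rewrite size_polyN size_polyX.
have [|x bx gx] := @poly_pos_above g (- b).
  rewrite lead_coefZ lead_coef_comp ?sX// lead_coefN lead_coefX mulrCA.
  by rewrite -expr2 sqrr_sign mulr1.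
exists (- x); first by rewrite ltrNl.
by move: gx; rewrite hornerZ horner_comp hornerN hornerX.
Qed.

(** The signs at the [m] given points alternate; one point far to the left and one far to the right
    supply the two outer sign changes, for [m + 1] intervals in all. *)
Lemma interlaces_of_signs m r f : increasing_upto m r ->
  (size f <= m.+2)%N -> f`_m.+1 = 1 ->
  (forall k, (k < m)%N -> 0 < (-1) ^+ (m - k) * f.[r k]) ->
  exists2 t, interlaces m r t & f = rootpoly m.+1 t.
Proof.
move=> rinc sf cf fr.
have szf : size f = m.+2.
  apply/eqP; rewrite eqn_leq sf /= ltnNge; apply/negP.
  by move=> /leq_sizeP/(_ _ (leqnn m.+1))/eqP; rewrite cf oner_eq0.
have lcf : 0 < lead_coef f by rewrite lead_coefE szf cf ltr01.
have [M rM fM] := poly_pos_above (r m.-1) lcf.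
have [N Nr] := poly_sign_below (Num.min (r 0%N) M) lcf; rewrite szf /= => fN.
move: Nr; rewrite lt_min => /andP[Nr NM].
pose a k := if k is k'.+1 then r k' else N.
pose b k := if (k < m)%N then r k else M.
have fa k : (k <= m)%N -> 0 < (-1) ^+ (m - k).+1 * f.[a k].
  case: k => [|k] km; first by rewrite subn0.
  by rewrite /= subnSK// fr.
have fb k : (k <= m)%N -> 0 < (-1) ^+ (m - k) * f.[b k].
  rewrite /b leq_eqVlt; case: ltnP => km; first by move=> _; exact: fr.
  by rewrite orbF => /eqP->; rewrite subnn mul1r.
have [||t -> tab] := @rootpoly_of_signs m.+1 f a b sf cf.
- move=> k; rewrite ltnS => km; split; last exact: sign_change_signr (fa _ km) (fb _ km).
  rewrite /a /b; case: k => [|k] in km *; first by case: ltnP.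
  case: ltnP => km'; first exact: rinc.
  by have -> : k = m.-1 by lia.
- by move=> k; rewrite ltnS => km; rewrite /b /a km.
exists t => // i im; have /andP[_] := tab i (ltnW im).
by rewrite /b im => ->; have /andP[] := tab i.+1 im.
Qed.

(** Suppose [t' k <= t k]. Since [t k < r k < t' (k+1)], the polynomials with roots [r] and [t']
    both have sign [(-1)^(m-k)] at [t k], the second one weakly; but the identity evaluated at [t k]
    gives them opposite signs. *)
Lemma interlaces_lt m r t t' c : interlaces m r t -> interlaces m r t' -> 0 < c ->
  rootpoly m.+1 t - rootpoly m.+1 t' = c *: rootpoly m r ->
  forall k, (k <= m)%N -> t k < t' k.
Proof.
move=> rt rt' c0 e k km; rewrite ltNge; apply/negP => tk.
have tinc := interlaces_outer rt; have t'inc := interlaces_outer rt'.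
have h1 : 0 < (-1) ^+ (m - k) * (rootpoly m r).[t k].
  apply: rootpoly_sign => // i ik.
    have /andP[_ h] := rt i (leq_trans ik km).
    exact: lt_le_trans h (increasing_upto_le tinc ik _).
  move=> im; have /andP[h _] := rt i im; apply: le_lt_trans h.
  by apply: (increasing_upto_le tinc ik); exact: ltnW.
have h2 : 0 <= (-1) ^+ (m.+1 - k.+1) * (rootpoly m.+1 t').[t k].
  apply: rootpoly_sign_weak => // i ik.
    by apply: le_trans tk; apply: (increasing_upto_le t'inc).
  rewrite ltnS => im; have km' : (k < m)%N by exact: leq_trans ik im.
  have /andP[/ltW h _] := rt k km'; have /andP[_ /ltW h'] := rt' k km'.
  by apply: le_trans h (le_trans h' _); exact: (increasing_upto_le t'inc ik).
have h0 : (rootpoly m.+1 t).[t k] = 0.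
  by rewrite /rootpoly horner_prod (bigD1 (Ordinal (km : k < m.+1)%N))//= hornerXsubC subrr mul0r.
have := congr1 (fun p => p.[t k]) e.
rewrite hornerD hornerN hornerZ h0 add0r => /eqP; rewrite eqr_oppLR => /eqP h3.
move: h2; rewrite subSS h3 mulrN mulrCA oppr_ge0 pmulr_rle0// leNgt.
by rewrite h1.
Qed.

Lemma rootpoly_inj m l l' : (forall i j, (i <= j)%N -> (j < m)%N -> l i <= l j) ->
  (forall i j, (i <= j)%N -> (j < m)%N -> l' i <= l' j) ->
  rootpoly m l = rootpoly m l' -> forall k, (k < m)%N -> l k = l' k.
Proof.
move=> li li' /[!rootpoly_mkseq] /prod_XsubC_eq e k km.
suff : mkseq l m = mkseq l' m by move/(congr1 (nth 0 ^~ k)); rewrite !nth_mkseq.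
have srt (l1 : nat -> R) : (forall i j, (i <= j)%N -> (j < m)%N -> l1 i <= l1 j) ->
    sorted <=%R (mkseq l1 m).
  move=> h; apply/(sortedP 0) => i; rewrite size_mkseq => im.
  by rewrite !nth_mkseq ?h// ltnW.
by apply: (sorted_eq le_trans le_anti) => //; apply: srt.
Qed.

Lemma rootpoly_of_uniq (s : seq R) : uniq s ->
  exists2 l, increasing_upto (size s) l & \prod_(x <- s) ('X - x%:P) = rootpoly (size s) l.
Proof.
move=> us; exists (nth 0 (sort <=%R s)).
  have : sorted <%R (sort <=%R s) by rewrite sort_lt_sorted.
  by rewrite -(size_sort <=%R) => h i j ij js; rewrite lt_sorted_ltn_nth// ?inE// (ltn_trans ij).
rewrite rootpoly_mkseq -(size_sort <=%R) mkseq_nth.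
by apply: perm_big; rewrite perm_sym perm_sort.
Qed.

End Interlacing.

(** * Averages of families of interlacing polynomials *)

Section Average.
Variable R : realType.
Implicit Types (p q f : {poly R}) (l r t : nat -> R) (n m k : nat) (s : seq R).

Lemma seq_max s x : x \in s -> exists2 y, y \in s & {in s, forall z, z <= y}.
Proof.
case: s => // a s _; elim: s a => [|b s IH] a.
  by exists a; rewrite ?mem_head// => z; rewrite inE => /eqP->.
have [y ys hy] := IH b; exists (Num.max a y).
  by rewrite /Num.max; case: ifP => _; rewrite inE ?eqxx// ys orbT.
move=> z; rewrite inE le_max => /predU1P[->|zs]; first by rewrite lexx.
by rewrite hy// orbT.
Qed.

Lemma seq_min s x : x \in s -> exists2 y, y \in s & {in s, forall z, y <= z}.
Proof.
move=> xs; have [y] := @seq_max (map -%R s) (- x) (map_f _ xs).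
move=> /mapP[z zs ->] h; exists z => // w ws.
by rewrite -lerN2 h// map_f.
Qed.

Lemma sum_pos s (F : R -> R) y : {in s, forall x, 0 <= F x} -> y \in s -> 0 < F y ->
  0 < \sum_(x <- s) F x.
Proof.
move=> h ys Fy; rewrite (perm_big _ (perm_to_rem ys)) big_cons ltr_pwDl//.
by rewrite big_seq sumr_ge0// => x /mem_rem/h.
Qed.

Lemma average_coef n s (H : R -> {poly R}) : s != [::] ->
  {in s, forall c, (size (H c) <= n.+1)%N /\ (H c)`_n = 1} ->
  let f := (size s)%:R^-1 *: \sum_(c <- s) H c in (size f <= n.+1)%N /\ f`_n = 1.
Proof.
move=> s0 h /=; split.
  apply/leq_sizeP => j nj; rewrite coefZ coef_sum big_seq big1 ?mulr0// => c /h[+ _].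
  by move/leq_sizeP; apply.
rewrite coefZ coef_sum (eq_big_seq (fun=> 1)) => [|c /h[]//].
by rewrite big_const_seq count_predT iter_addr_0 mulVf// pnatr_eq0 size_eq0.
Qed.

(* The roots of [H c] decrease as [c] grows and share their separating intervals,
   so at a root of [\sum_c H c] the values of [H c] change sign exactly once as [c]
   increases; this determines the sign of [\sum_c c * H c] there. *)
Lemma average_interlaces m s (H : R -> {poly R}) c0 d0 :
  c0 \in s -> d0 \in s -> c0 != d0 ->
  {in s &, forall c d, c < d -> exists r t t',
    [/\ interlaces m r t, interlaces m r t', H c = rootpoly m.+1 t,
        H d = rootpoly m.+1 t' & H d - H c = (d - c) *: rootpoly m r]} ->
  exists r, (size s)%:R^-1 *: \sum_(c <- s) H c = rootpoly m.+1 r /\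
    forall a, exists2 t, interlaces m.+1 r t &
    (size s)%:R^-1 *: \sum_(c <- s) ('X - (a + c)%:P) * H c = rootpoly m.+2 t.
Proof.
move=> c0s d0s cd0 hH.
have [M Ms sM] := seq_max c0s; have [u us su] := seq_min c0s.
have uM : u < M.
  rewrite lt_neqAle su// andbT; apply: contra_neq cd0 => uM.
  have e z : z \in s -> z = u by move=> zs; apply: le_anti; rewrite su// uM sM.
  by rewrite (e _ c0s) (e _ d0s).
have s0 : s != [::] by apply: contraTneq c0s => ->.
have sz0 : (0 : R) < (size s)%:R^-1 by rewrite invr_gt0 ltr0n lt0n size_eq0.
(* [L c] lists the roots of [H c]. Every [c] in [s] differs from the minimum [u] or from the maximum
   [M], so the hypothesis on pairs applies to it. *)
have /choice[L LP] : forall c, exists t, c \in s ->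
    increasing_upto m.+1 t /\ H c = rootpoly m.+1 t.
  move=> c; case: (boolP (c \in s)) => cs; last by exists (fun=> 0).
  case: (ltP u c) => uc.
    have [r [t [t' [_ h1 _ h2 _]]]] := hH u c us cs uc.
    by exists t' => _; split => //; exact: interlaces_outer h1.
  have [r [t [t' [h1 _ h2 _ _]]]] := hH c M cs Ms (le_lt_trans uc uM).
  by exists t => _; split => //; exact: interlaces_outer h1.
have Linc c : c \in s -> increasing_upto m.+1 (L c) by move=> /LP[].
have HL c : c \in s -> H c = rootpoly m.+1 (L c) by move=> /LP[].
have Leq c t : c \in s -> increasing_upto m.+1 t -> H c = rootpoly m.+1 t ->
    forall k, (k < m.+1)%N -> L c k = t k.
  move=> cs ti; rewrite HL//; apply: rootpoly_inj => i j ij jm.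
    exact: increasing_upto_le (Linc _ cs) ij jm.
  exact: increasing_upto_le ti ij jm.
have Ldecr c d k : c \in s -> d \in s -> c < d -> (k < m.+1)%N -> L d k < L c k.
  move=> cs ds cd km.
  have [r [t [t' [h1 h2 h3 h4 h5]]]] := hH c d cs ds cd.
  rewrite (Leq _ _ cs _ h3)// ?(Leq _ _ ds _ h4)//.
  - apply: (interlaces_lt (c := d - c) h2 h1) => //; first by rewrite subr_gt0.
    by rewrite -h3 -h4.
  - exact: interlaces_outer h2.
  - exact: interlaces_outer h1.
(* With [Ldecr], this places all [k]-th roots between [L M k] and [L u k], and makes these intervals
   disjoint and ordered by [k]. *)
have Lcross c d i j : c \in s -> d \in s -> (i < j)%N -> (j < m.+1)%N -> L c i < L d j.
  move=> cs ds; case: j => // j; rewrite ltnS => ij jm.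
  apply: (le_lt_trans (increasing_upto_le (Linc _ cs) ij (ltnW jm))).
  have [cd|dc|->] := ltrgtP c d; last exact: Linc.
    have [r [t [t' [h1 h2 h3 h4 h5]]]] := hH c d cs ds cd.
    rewrite (Leq _ _ cs (interlaces_outer h1) h3) ?(Leq _ _ ds (interlaces_outer h2) h4)//;
      last exact: ltnW.
    have /andP[h _] := h1 j jm; have /andP[_ h'] := h2 j jm; exact: lt_trans h'.
  apply: lt_trans (Ldecr _ _ j.+1 ds cs dc jm).
  exact: Linc.
pose F1 := (size s)%:R^-1 *: \sum_(c <- s) H c.
have HF x : F1.[x] = (size s)%:R^-1 * \sum_(c <- s) (H c).[x].
  by rewrite hornerZ horner_sum.
have [szF1 cF1] : (size F1 <= m.+2)%N /\ F1`_m.+1 = 1.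
  apply: average_coef => // c cs; rewrite HL//.
  by rewrite size_rootpoly coef_rootpoly.
(* At [L M k] no [H c] is past its [k]-th root, at [L u k] none is before it. So all values share a
   weak sign at each end, strict for [u] at the left end and for [M] at the right end. *)
have [||r F1r rML] := @rootpoly_of_signs _ m.+1 F1 (L M) (L u) szF1 cF1.
- move=> k km; split; first exact: Ldecr.
  have km' : (k <= m)%N by [].
  apply: (@sign_change_signr _ _ _ (m - k)); rewrite HF mulrCA mulr_gt0// mulr_sumr.
    apply: (@sum_pos _ _ u) => // [c cs|]; rewrite HL// -subSn//.
      apply: rootpoly_sign_weak; [exact: ltnW|by move=> i ik; exact/ltW/Lcross|].
      move=> i ki im; apply: (@le_trans _ _ (L M i)).
        exact: increasing_upto_le (Linc _ Ms) ki im.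
      have := sM _ cs; rewrite le_eqVlt => /predU1P[->//|cM]; exact/ltW/Ldecr.
    apply: rootpoly_sign; [exact: ltnW|by move=> i ik; exact: Lcross|].
    move=> i ki im; apply: (@le_lt_trans _ _ (L M i)).
      exact: increasing_upto_le (Linc _ Ms) ki im.
    exact: Ldecr.
  apply: (@sum_pos _ _ M) => // [c cs|]; rewrite HL// -subSS.
    apply: rootpoly_sign_weak => // [i ik|i ki im]; last exact/ltW/Lcross.
    apply: (@le_trans _ _ (L u i)); last exact: increasing_upto_le (Linc _ us) (ltnSE ik) km.
    have := su _ cs; rewrite le_eqVlt => /predU1P[->//|cM]; apply/ltW/Ldecr => //.
    exact: leq_trans km.
  apply: rootpoly_sign => // [i ik|i ki im]; last exact: Lcross.
  apply: (@lt_le_trans _ _ (L u i)); last exact: increasing_upto_le (Linc _ us) (ltnSE ik) km.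
  by apply: Ldecr => //; exact: leq_trans km.
- by move=> k km; exact/ltW/Lcross.
exists r; split => // a.
pose F2 := (size s)%:R^-1 *: \sum_(c <- s) ('X - (a + c)%:P) * H c.
have [szF2 cF2] : (size F2 <= m.+3)%N /\ F2`_m.+2 = 1.
  apply: average_coef => // c cs; rewrite HL//.
  rewrite size_monicM ?monicXsubC ?size_XsubC ?size_rootpoly//; last first.
    by rewrite -size_poly_gt0 size_rootpoly.
  split=> //.
  by rewrite mulrBl coefB coefXM coefCM coef_rootpoly /= nth_default ?size_rootpoly// mulr0 subr0.
have rinc : increasing_upto m.+1 r.
  apply: increasing_upto_succ => i im.
  have /andP[_ h1] := rML i (ltnW im); have /andP[h2 _] := rML _ im.
  exact: lt_trans h1 (lt_trans (Lcross _ _ _ _ us Ms _ im) h2).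
have [//|t ht F2t] := interlaces_of_signs rinc szF2 cF2; last by exists t.
move=> k km; have /andP[Mr ru] := rML k km.
have km' : (k <= m)%N by [].
have sum0 : \sum_(c <- s) (H c).[r k] = 0.
  suff /eqP : F1.[r k] = 0 by rewrite HF mulf_eq0 (gt_eqF sz0) => /eqP.
  by rewrite F1r /rootpoly horner_prod (bigD1 (Ordinal km))//= hornerXsubC subrr mul0r.
(* [w] is the threshold of the sign change: the [k]-th root of [H c] is at least [r k] for [c <= w]
   and below it for [c > w]. *)
have [w] : exists2 w, w \in [seq c <- s | r k <= L c k] &
    {in [seq c <- s | r k <= L c k], forall z, z <= w}.
  by apply: (@seq_max _ u); rewrite mem_filter us ltW.
rewrite mem_filter => /andP[rw ws] hw.
(* The values [(H c).[r k]] sum to zero, so the weights [r k - a - c] may be replaced by [w - c],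
   which change sign together with these values. This removes [a]. *)
have F2E : F2.[r k] = (size s)%:R^-1 * \sum_(c <- s) (w - c) * (H c).[r k].
  rewrite hornerZ horner_sum; congr (_ * _).
  transitivity (\sum_(c <- s) ((w - c) * (H c).[r k] + (r k - a - w) * (H c).[r k])).
    by apply: eq_bigr => c _; rewrite hornerM hornerXsubC; ring.
  by rewrite big_split /= -[X in _ + X]mulr_sumr sum0 mulr0 addr0.
have sgn_pos c : c \in s -> r k < L c k -> 0 < (-1) ^+ (m.+1 - k) * (H c).[r k].
  move=> cs rc; rewrite HL//; apply: rootpoly_sign => [|i ik|i ki im]; first exact: ltnW.
    by apply: lt_trans Mr; exact: Lcross.
  exact: lt_le_trans rc (increasing_upto_le (Linc _ cs) ki im).
have sgn_neg c : c \in s -> L c k < r k -> (-1) ^+ (m.+1 - k) * (H c).[r k] < 0.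
  move=> cs rc; rewrite subSn// exprS -mulrA mulN1r oppr_lt0 -subSS HL//.
  apply: rootpoly_sign => // [i ik|i ki im].
    exact: le_lt_trans (increasing_upto_le (Linc _ cs) (ltnSE ik) km) rc.
  by apply: (lt_trans ru); exact: Lcross.
rewrite F2E mulrCA mulr_gt0// mulr_sumr.
have wM : w < M.
  rewrite lt_neqAle sM// andbT; apply: contraTneq rw => ->.
  by rewrite -ltNge.
apply: (@sum_pos _ _ M) => // [c cs|]; last first.
  by rewrite mulrCA nmulr_rgt0 ?subr_lt0// sgn_neg.
rewrite mulrCA; have [wc|cw|->] := ltrgtP w c; last by rewrite subrr mul0r.
  rewrite nmulr_rge0 ?subr_lt0// ltW// sgn_neg// ltNge; apply: contraL wc => rc.
  by rewrite -leNgt hw// mem_filter rc.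
rewrite pmulr_rge0 ?subr_gt0// ltW// sgn_pos//.
exact: le_lt_trans rw (Ldecr _ _ _ cs ws cw km).
Qed.

End Average.

(** * Interlacing of convolutions *)

Section ConvolutionInterlacing.
Variable R : realType.
Implicit Types (p q f : {poly R}) (l r t : nat -> R) (n m k : nat) (s u v : seq R).

Local Notation conv := (@finite_free_conv R).
Local Notation P s := (\prod_(x <- s) ('X - x%:P)).

Lemma rem_nseqS n (c : R) : rem c (nseq n.+1 c) = nseq n c.
Proof. by rewrite /= eqxx. Qed.

Lemma conv_prod_nseq u c :
  conv (size u) (P u) (P (nseq (size u) c)) = P (map (+%R^~ c) u).
Proof.
elim: u => [|a u IH]; first by rewrite !big_nil finite_free_conv0_1.
rewrite conv_prod_cons ?size_nseq// big_nseq iter_addr_0 rem_nseqS IH -[X in _ *: X]scaler_nat.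
by rewrite scalerA mulVf ?pnatr_eq0// scale1r big_cons.
Qed.

Lemma conv_prod_shift u v c : size u = size v ->
  conv (size u) (P (map (+%R^~ c) u)) (P v) = conv (size u) (P u) (P v) \Po ('X - c%:P).
Proof.
elim: u v => [|a u IH] v uv.
  by rewrite (size0nil (esym uv)) !big_nil finite_free_conv0_1 comp_polyC.
rewrite !conv_prod_cons ?size_map// comp_polyZ; congr (_ *: _); rewrite raddf_sum.
apply: eq_big_seq => b bv; rewrite /= comp_polyM IH ?size_rem -?uv//; congr (_ * _).
by rewrite comp_polyB comp_polyX comp_polyC !polyCD; ring.
Qed.

Lemma prod_map_shift (u : seq R) (c : R) : P (map (+%R^~ c) u) = P u \Po ('X - c%:P).
Proof.
rewrite big_map rmorph_prod; apply: eq_bigr => x _.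
by rewrite /= comp_polyB comp_polyX comp_polyC polyCD; ring.
Qed.

(** At a critical point of the polynomial the multiple of the derivative vanishes, so the signs
    there do not depend on [e]. *)
Lemma deriv_interlaces m l : increasing_upto m.+1 l ->
  exists r, m.+1%:R^-1 *: (rootpoly m.+1 l)^`() = rootpoly m r /\
    forall e, exists2 t, interlaces m r t &
      rootpoly m.+1 l + e *: (rootpoly m.+1 l)^`() = rootpoly m.+1 t.
Proof.
move=> li; set f := rootpoly m.+1 l.
have sf : size f = m.+2 by rewrite size_rootpoly.
have sdf : (size f^`() <= m.+1)%N.
  by apply/leq_sizeP => j mj; rewrite coef_deriv nth_default ?mul0rn// sf.
have dfl k : (k <= m)%N -> 0 < (-1) ^+ (m - k) * (f^`()).[l k].
  move=> km; have km' : (k < m.+1)%N by [].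
  have -> : f = ('X - (l k)%:P) * rootpoly m (fun i => l (bump k i)).
    by rewrite /f /rootpoly (bigD1_ord (Ordinal km')).
  rewrite derivM derivXsubC mul1r hornerD hornerM hornerXsubC subrr mul0r addr0.
  apply: rootpoly_sign => // [i ik|i ki im].
    by rewrite /bump leqNgt ik; exact: li.
  by rewrite /bump ki; apply: li; lia.
have m0 : (0 : R) < m.+1%:R^-1 by rewrite invr_gt0 ltr0n.
have [||||r fr rl] := @rootpoly_of_signs _ m (m.+1%:R^-1 *: f^`()) l (l \o succn).
- by apply: leq_trans sdf; exact: size_scale_leq.
- by rewrite coefZ coef_deriv coef_rootpoly mulVf// pnatr_eq0.
- move=> k km; split; first exact: li.
  apply: (@sign_change_signr _ _ _ (m - k.+1)); rewrite hornerZ mulrCA mulr_gt0//.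
    by rewrite subnSK// dfl// ltnW.
  exact: dfl.
- by move=> k km /=.
exists r; split => // e.
have rinc : increasing_upto m r.
  apply: increasing_upto_succ => i im.
  have /andP[_ h1] := rl i (ltnW im); have /andP[h2 _] := rl _ im.
  exact: lt_trans h1 h2.
have [|||t rt ft] := @interlaces_of_signs _ m r (f + e *: f^`()) rinc; last by exists t.
- rewrite (leq_trans (size_polyD _ _))// geq_max sf leqnn /=.
  by rewrite (leq_trans (size_scale_leq _ _))// leqW.
- by rewrite coefD coefZ coef_rootpoly (leq_sizeP _ _ sdf)// mulr0 addr0.
move=> k km; have dr : (f^`()).[r k] = 0.
  suff /eqP : (m.+1%:R^-1 *: f^`()).[r k] = 0.
    by rewrite hornerZ mulf_eq0 (gt_eqF m0) => /eqP.
  by rewrite fr /rootpoly horner_prod (bigD1 (Ordinal km))//= hornerXsubC subrr mul0r.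
rewrite hornerD hornerZ dr mulr0 addr0 -subSS; have /andP[h1 h2] := rl k km.
apply: rootpoly_sign => [|i ik|i ki im]; first exact: ltnW.
  by apply: le_lt_trans h1; apply: (increasing_upto_le li (ltnSE ik)); exact: ltnW.
by apply: (lt_le_trans h2); exact: (increasing_upto_le li).
Qed.

Lemma conv_cons_sub n p c d s :
  conv n p (P (c :: s)) - conv n p (P (d :: s)) = (d - c) *: conv n p (P s).
Proof.
have -> : P (c :: s) = P (d :: s) + (d - c) *: P s.
  by rewrite !big_cons -mul_polyC polyCB; ring.
by rewrite finite_free_convDr finite_free_convZr addrAC subrr add0r.
Qed.

(** Deletion of a root of the second factor, which may be a point mass. The same [r] serves all [b]:
    this is what lets two members of an averaged family be compared. *)
Definition conv_interlaces_any m := forall u v, uniq u -> size u = m.+1 -> size v = m ->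
  exists r, conv m.+1 (P u) (P v) = rootpoly m r /\
    forall b, exists2 t, interlaces m r t &
      conv m.+1 (P u) (P (b :: v)) = rootpoly m.+1 t.

(** Deletion of a root of the simple factor. For constant [v] both convolutions would be translates,
    of [P u] and of [P (a :: u)], with common roots instead of strict interlacing. *)
Definition conv_interlaces_nonconst m := forall u v,
  uniq u -> size u = m -> size v = m.+1 -> ~~ constant v ->
  exists r, conv m.+1 (P u) (P v) = rootpoly m r /\
    forall a, a \notin u -> exists2 t, interlaces m r t &
      conv m.+1 (P (a :: u)) (P v) = rootpoly m.+1 t.

Lemma nonconst_pair s : ~~ constant s -> exists c d, [/\ c \in s, d \in s & c != d].
Proof.
case: s => // a s; rewrite /= => /allPn[x xs xa]; exists a, x.
by rewrite mem_head inE xs orbT eq_sym; split.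
Qed.

Lemma prod_XsubC_rem2 c d s : c \in s -> d \in s -> c != d ->
  P (rem c s) = P (d :: rem d (rem c s)) /\ P (rem d s) = P (c :: rem d (rem c s)).
Proof.
move=> cs ds cd.
have dc : d \in rem c s by apply: rem_mem => //; rewrite eq_sym.
have h1 := perm_to_rem dc; split; first exact: perm_big.
apply: perm_big; rewrite -(perm_cons d).
rewrite -(permPl (perm_to_rem ds)) (permPl (perm_to_rem cs)).
rewrite (permPr (_ : perm_eq _ [:: c, d & rem d (rem c s)])) ?perm_cons//.
rewrite -[d :: c :: _]/([:: d; c] ++ _) -[c :: d :: _]/([:: c; d] ++ _) perm_cat2r.
by apply/permP => x /=; lia.
Qed.

(** The average runs over the roots of [v]. Two members, with [c] or [d] deleted, arise from the
    common rest of [v] by adding [d] or [c], and the other statement covers an arbitrary rest. *)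
Lemma conv_interlaces_nonconstS m :
  conv_interlaces_any m -> conv_interlaces_nonconst m.+1.
Proof.
move=> IH u v uu su sv /nonconst_pair[c0 [d0 [c0v d0v cd0]]].
pose H c := conv m.+1 (P u) (P (rem c v)).
have [|r [hr ht]] := @average_interlaces _ m v H _ _ c0v d0v cd0.
  move=> c d cv dv cd; have [e1 e2] := prod_XsubC_rem2 cv dv (negbT (lt_eqF cd)).
  set w := rem d (rem c v) in e1 e2.
  have [|r [hr ht]] := IH u w uu su.
    rewrite !size_rem// ?sv//; apply: rem_mem => //; by rewrite gt_eqF.
  have [t rt et] := ht d; have [t' rt' et'] := ht c.
  exists r, t, t'; rewrite /H e1 e2; split => //.
  by rewrite conv_cons_sub hr.
exists r; split; first by rewrite conv_prod_lower// -hr sv.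
by move=> a _; have [t rt et] := ht a; exists t => //; rewrite conv_prod_cons// -et sv.
Qed.

(** The average runs over the roots of [u], whose rests stay simple, while [v] remains whole. A
    constant [v] falls outside the other statement; the two averages are then a normalised
    derivative and a polynomial plus a multiple of its derivative. *)
Lemma conv_interlaces_anyS m :
  conv_interlaces_nonconst m -> conv_interlaces_any m.+1.
Proof.
move=> IH u v uu su sv.
have lowE : conv m.+2 (P u) (P v) = m.+2%:R^-1 *: \sum_(a <- u) conv m.+1 (P (rem a u)) (P v).
  rewrite finite_free_convC conv_prod_lower//; congr (_ *: _).
  by apply: eq_bigr => a _; rewrite finite_free_convC.
have consE b : conv m.+2 (P u) (P (b :: v)) =
    m.+2%:R^-1 *: \sum_(a <- u) ('X - (b + a)%:P) * conv m.+1 (P (rem a u)) (P v).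
  rewrite finite_free_convC conv_prod_cons//; congr (_ *: _).
  by apply: eq_bigr => a _; rewrite finite_free_convC.
have [/(constantP 0)|nv] := boolP (constant v).
  move=> [c]; rewrite sv => vE.
  have remE a : a \in u -> conv m.+1 (P (rem a u)) (P v) = P (rem (a + c) (map (+%R^~ c) u)).
    move=> au; have srem : size (rem a u) = m.+1 by rewrite size_rem// su.
    rewrite vE -srem conv_prod_nseq; apply: perm_big.
    have := map_f (+%R^~ c) au => /perm_to_rem h.
    have := perm_map (+%R^~ c) (perm_to_rem au).
    by rewrite (permPl h) /= perm_cons perm_sym.
  have [] := @rootpoly_of_uniq _ (map (+%R^~ c) u).
    by rewrite map_inj_uniq//; exact: addIr.
  rewrite size_map su => l li lE.
  have sumE : \sum_(a <- u) conv m.+1 (P (rem a u)) (P v) = (rootpoly m.+2 l)^`().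
    by rewrite -lE deriv_prod_XsubC big_map; apply: eq_big_seq => a /remE.
  have [r [hr ht]] := deriv_interlaces li.
  exists r; split; first by rewrite lowE sumE.
  (* From [X - (b + a) = (X - (a + c)) + (c - b)]: the first part restores the full product in each
     of the [m + 2] summands, the second contributes [c - b] times the derivative. *)
  move=> b; have [t rt et] := ht ((c - b) / m.+2%:R); exists t => //.
  have sumP : \sum_(a <- u) ('X - (a + c)%:P) * conv m.+1 (P (rem a u)) (P v) =
      m.+2%:R *: rootpoly m.+2 l.
    transitivity (\sum_(a <- u) rootpoly m.+2 l); last first.
      by rewrite big_const_seq count_predT iter_addr_0 su scaler_nat.
    apply: eq_big_seq => a au; rewrite remE// -lE -prod_XsubC_rem//.
    exact: (map_f (+%R^~ c)).
  have lE2 : rootpoly m.+2 l = m.+2%:R^-1 *: (m.+2%:R *: rootpoly m.+2 l).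
    by rewrite scalerA mulVf ?pnatr_eq0// scale1r.
  rewrite consE -et -sumE lE2 -sumP mulrC -scalerA -scalerDr; congr (_ *: _).
  rewrite scaler_sumr -big_split; apply: eq_bigr => a _ /=.
  by rewrite -mul_polyC !polyCD polyCN; ring.
have /nonconst_pair[c0 [d0 [c0u d0u cd0]]] : ~~ constant u.
  case: u uu su {lowE consE} => [|x [|y u]]//=.
  by rewrite inE negb_or eq_sym => /andP[/andP[/negbTE->]].
pose H c := conv m.+1 (P (rem c u)) (P v).
have [|r [hr ht]] := @average_interlaces _ m u H _ _ c0u d0u cd0.
  move=> c d cv dv cd; have [e1 e2] := prod_XsubC_rem2 cv dv (negbT (lt_eqF cd)).
  set w := rem d (rem c u) in e1 e2.
  have [||r [hr ht]] := IH w v _ _ sv nv; first by rewrite !rem_uniq.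
    rewrite !size_rem// ?su//; apply: rem_mem => //; by rewrite gt_eqF.
  have [|t rt et] := ht d; first by rewrite mem_rem_uniqF ?rem_uniq.
  have [|t' rt' et'] := ht c.
    by apply/negP => /mem_rem; rewrite mem_rem_uniqF.
  exists r, t, t'; rewrite /H e1 e2; split => //.
  by rewrite ![conv _ _ (P v)]finite_free_convC conv_cons_sub finite_free_convC hr.
exists r; split; first by rewrite lowE -hr su.
by move=> b; have [t rt et] := ht b; exists t => //; rewrite consE -et su.
Qed.

End ConvolutionInterlacing.

(** * Strict monotonicity of the root map *)

Section OmegaTheory.
Variable R : realType.
Implicit Types (p q f : {poly R}) (l r t : nat -> R) (n m k : nat) (s u v : seq R).

Local Notation conv := (@finite_free_conv R).
Local Notation P s := (\prod_(x <- s) ('X - x%:P)).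

Lemma conv_interlaces m :
  conv_interlaces_any R m /\ conv_interlaces_nonconst R m.
Proof.
elim: m => [|m [h1 h2]]; last first.
  by split; [exact: conv_interlaces_anyS | exact: conv_interlaces_nonconstS].
(* For [m = 0] the sequence [v] has length one, hence is constant. *)
split; last by move=> u [|? []].
move=> [|a []]// [|//] _ _ _; exists (fun=> 0); split.
  rewrite finite_free_convC conv_prod_lower// big_seq1 /= eqxx !big_nil finite_free_conv0_1.
  by rewrite invr1 scale1r /rootpoly big_ord0.
move=> b; exists (fun=> b + a) => //.
rewrite finite_free_convC conv_prod_cons// big_seq1 /= eqxx !big_nil finite_free_conv0_1.
by rewrite invr1 scale1r mulr1 /rootpoly big_ord1.
Qed.

(** The factor ['X] shifts the second highest coefficient to index [size s], which also gives the
    right value 0 for empty [s]. *)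
Lemma coef_X_prod_XsubC s : ('X * P s)`_(size s) = - \sum_(x <- s) x.
Proof.
elim: s => [|a s IH]; first by rewrite !big_nil mulr1 coefX oppr0.
rewrite coefXM /= !big_cons mulrBl coefB IH coefCM opprD addrC.
have /monicP := monic_prod_XsubC s xpredT id.
by rewrite lead_coefE size_prod_XsubC /= => ->; rewrite mulr1.
Qed.

(** In the expansion along the first root of [u], every summand already has these two coefficients,
    and so has their average. *)
Lemma coef_conv_prod u v : size u = size v ->
  (conv (size u) (P u) (P v))`_(size u) = 1 /\
  ('X * conv (size u) (P u) (P v))`_(size u) = - \sum_(x <- u) x - \sum_(x <- v) x.
Proof.
elim: u v => [|a u IH] v uv.
  rewrite (size0nil (esym uv)) !big_nil finite_free_conv0_1.
  by rewrite mulr1 coefX coef1 subr0 oppr0.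
rewrite conv_prod_cons// -scalerAr !coefZ; set n := size u.
have [sn sv] : size u = n /\ size v = n.+1 by split.
have key b : b \in v -> (('X - (a + b)%:P) * conv n (P u) (P (rem b v)))`_n.+1 = 1 /\
    (('X - (a + b)%:P) * conv n (P u) (P (rem b v)))`_n =
      - (\sum_(x <- a :: u) x) - \sum_(x <- v) x.
  move=> bv; have [|h1 h2] := IH (rem b v); first by rewrite size_rem ?sv.
  have szh : (size (conv n (P u) (P (rem b v))) <= n.+1)%N.
    apply: (leq_trans (size_sum _ _ _)); apply/bigmax_leqP => k _.
    by rewrite (leq_trans (size_scale_leq _ _))// size_polyXn ltnS leq_subr.
  rewrite mulrBl !coefB !coefCM h1 h2 coefXM /= h1 nth_default// mulr0 subr0; split => //.
  by rewrite big_cons [X in _ = _ - X](perm_big _ (perm_to_rem bv)) /= big_cons; ring.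
have const_sum (F : R -> {poly R}) k x : {in v, forall b, (F b)`_k = x} ->
    n.+1%:R^-1 * (\sum_(b <- v) F b)`_k = x.
  move=> h; rewrite coef_sum (eq_big_seq _ h) big_const_seq count_predT iter_addr_0 sv.
  by rewrite -[x *+ _]mulr_natl mulKf// pnatr_eq0.
split; first by apply: const_sum => b /key[].
by rewrite coefXM /=; apply: const_sum => b /key[].
Qed.

Section Vectors.
Variable m : nat.
Local Notation n := m.+1.
Implicit Types (alpha beta gamma : 'rV[R]_n).

Definition entries alpha : seq R := [seq alpha 0 i | i <- enum 'I_n].

Lemma size_entries alpha : size (entries alpha) = n.
Proof. by rewrite size_map size_enum_ord. Qed.

Lemma poly_of_rootsE alpha : poly_of_roots alpha = P (entries alpha).
Proof. by rewrite big_map big_enum. Qed.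

Lemma sum_entries alpha : \sum_(x <- entries alpha) x = \sum_i alpha 0 i.
Proof. by rewrite big_map big_enum. Qed.

Lemma poly_of_roots_inord alpha :
  poly_of_roots alpha = rootpoly n (fun k => alpha 0 (inord k)).
Proof. by apply: eq_bigr => i _; rewrite inord_val. Qed.

Lemma rootpoly_row l : rootpoly n l = poly_of_roots (\row_(i < n) l i).
Proof. by apply: eq_bigr => i _; rewrite mxE. Qed.

Lemma increasing_nondecreasing alpha : increasing_vec alpha -> nondecreasing_vec alpha.
Proof.
move=> h i j; rewrite leq_eqVlt => /predU1P[/val_inj->//|/h/ltW//].
Qed.

Lemma increasing_vec_inj alpha : increasing_vec alpha -> injective (alpha 0).
Proof.
move=> h i j e; apply: val_inj; case: (ltngtP i j) => // /h; by rewrite e ltxx.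
Qed.

Lemma poly_of_roots_inj alpha gamma :
  nondecreasing_vec alpha -> nondecreasing_vec gamma ->
  poly_of_roots alpha = poly_of_roots gamma -> alpha = gamma.
Proof.
move=> ha hg; rewrite !poly_of_roots_inord => e; apply/rowP => i.
rewrite -[i]inord_val; apply: (rootpoly_inj _ _ e) => // j k jk kn.
  by apply: ha; rewrite !inordK// (leq_ltn_trans jk kn).
by apply: hg; rewrite !inordK// (leq_ltn_trans jk kn).
Qed.

Lemma root_vec_poly_of_roots alpha : nondecreasing_vec alpha ->
  root_vec n (poly_of_roots alpha) = alpha.
Proof.
move=> ha; rewrite /root_vec; apply: xget_unique => // gamma [hg] /esym.
exact: poly_of_roots_inj.
Qed.

(** Walsh's theorem in a strict form for one simple factor: the convolution is the outer polynomial
    when any root of the second factor is deleted. *)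
Lemma conv_real_rooted alpha beta : injective (alpha 0) ->
  exists2 gamma : 'rV[R]_n, increasing_vec gamma &
    conv n (poly_of_roots alpha) (poly_of_roots beta) = poly_of_roots gamma.
Proof.
move=> ai; have [h _] := conv_interlaces m.
have := size_entries beta; rewrite !poly_of_rootsE.
case: (entries beta) => // b v [sv].
have [||r [_ /(_ b)[t rt ->]]] := h (entries alpha) v _ _ sv.
- by rewrite map_inj_uniq// enum_uniq.
- exact: size_entries.
exists (\row_(i < n) t i); last exact: rootpoly_row.
by move=> i j ij; rewrite !mxE; exact: interlaces_outer rt _ _ _ _.
Qed.

Lemma OmegaP alpha beta : increasing_vec alpha ->
  increasing_vec (Omega alpha beta) /\
  conv n (poly_of_roots alpha) (poly_of_roots beta) = poly_of_roots (Omega alpha beta).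
Proof.
move=> /increasing_vec_inj/(conv_real_rooted beta)[gamma hg e].
by rewrite /Omega e root_vec_poly_of_roots//; exact: increasing_nondecreasing.
Qed.

Lemma Omega_shift alpha beta c : increasing_vec alpha ->
  Omega (alpha + const_mx c) beta = Omega alpha beta + const_mx c.
Proof.
move=> ha; have [hO e] := OmegaP beta ha.
have shiftE (gamma : 'rV[R]_n) : poly_of_roots (gamma + const_mx c) =
    P (map (+%R^~ c) (entries gamma)).
  rewrite poly_of_rootsE -map_comp; congr (\prod_(x <- _) _).
  by apply: eq_map => i; rewrite /= !mxE.
apply: poly_of_roots_inj.
- apply: increasing_nondecreasing; apply: (OmegaP _ _).1 => i j ij.
  by rewrite !mxE ltrD2r ha.
- by move=> i j ij; rewrite !mxE lerD2r; exact: increasing_nondecreasing.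
rewrite -(OmegaP _ _).2; last by move=> i j ij; rewrite !mxE ltrD2r ha.
rewrite !shiftE poly_of_rootsE -{1}(size_entries alpha) conv_prod_shift ?size_entries//.
by rewrite prod_map_shift -!poly_of_rootsE e.
Qed.

Lemma Omega_sum alpha beta : increasing_vec alpha ->
  \sum_i Omega alpha beta 0 i = \sum_i alpha 0 i + \sum_i beta 0 i.
Proof.
move=> ha; have [_] := OmegaP beta ha; rewrite !poly_of_rootsE.
move=> /(congr1 (fun p => ('X * p)`_n)).
have [|_] := @coef_conv_prod (entries alpha) (entries beta); first by rewrite !size_entries.
have := coef_X_prod_XsubC (entries (Omega alpha beta)).
rewrite !size_entries => -> ->.
by rewrite -opprD => /oppr_inj; rewrite !sum_entries.
Qed.

(** Both convolutions strictly interlace the one obtained from the common entries [w], and they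
    differ by a positive multiple of it. *)
Lemma Omega_step alpha gamma beta i0 : ~~ constant (entries beta) ->
  increasing_vec alpha -> increasing_vec gamma ->
  (forall i, i != i0 -> alpha 0 i = gamma 0 i) -> alpha 0 i0 < gamma 0 i0 ->
  forall i, Omega alpha beta 0 i < Omega gamma beta 0 i.
Proof.
move=> hb ha hg hag lt0 i.
pose w := [seq alpha 0 i | i <- rem i0 (enum 'I_n)].
have ie : i0 \in enum 'I_n by rewrite mem_enum.
have aE : perm_eq (entries alpha) (alpha 0 i0 :: w).
  exact: (perm_map (alpha 0) (perm_to_rem ie)).
have gE : perm_eq (entries gamma) (gamma 0 i0 :: w).
  have -> : w = [seq gamma 0 i | i <- rem i0 (enum 'I_n)].
    apply/eq_in_map => j; rewrite mem_rem_uniq ?enum_uniq// inE => /andP[ji _].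
    exact: hag.
  exact: (perm_map (gamma 0) (perm_to_rem ie)).
have ua : uniq (alpha 0 i0 :: w).
  by rewrite -(perm_uniq aE) map_inj_uniq ?enum_uniq//; exact: increasing_vec_inj.
have ug : uniq (gamma 0 i0 :: w).
  by rewrite -(perm_uniq gE) map_inj_uniq ?enum_uniq//; exact: increasing_vec_inj.
have sw : size w = m by rewrite size_map size_rem// size_enum_ord.
move: ua ug; rewrite /= => /andP[aw uw] /andP[gw _].
have [r [hr ht]] := (conv_interlaces m).2 w (entries beta) uw sw (size_entries beta) hb.
have [t rt et] := ht _ aw; have [t' rt' et'] := ht _ gw.
have OE (delta : 'rV[R]_n) x y : increasing_vec delta -> perm_eq (entries delta) (x :: w) ->
    interlaces m r y -> conv n (P (x :: w)) (P (entries beta)) = rootpoly n y ->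
    forall k : 'I_n, Omega delta beta 0 k = y k.
  move=> hd dE hy ye k; rewrite -[k in LHS]inord_val.
  apply: (@rootpoly_inj _ n (fun k => Omega delta beta 0 (inord k))) => //.
  - move=> j j' jj' jn; apply: increasing_nondecreasing; first exact: (OmegaP _ hd).1.
    by rewrite !inordK// (leq_ltn_trans jj' jn).
  - by move=> j j' jj' jn; exact: (increasing_upto_le (interlaces_outer hy)) jj' jn.
  - rewrite -poly_of_roots_inord -(OmegaP _ hd).2 !poly_of_rootsE.
    by rewrite (perm_big _ dE) ye.
rewrite (OE _ _ _ ha aE rt et) (OE _ _ _ hg gE rt' et').
apply: (interlaces_lt (c := gamma 0 i0 - alpha 0 i0) rt rt'); rewrite ?subr_gt0//;
  last by rewrite -ltnS.
by rewrite -et -et' -hr ![conv _ _ (P (entries beta))]finite_free_convC conv_cons_sub.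
Qed.

Lemma Omega_strict_mono alpha gamma beta : ~~ constant (entries beta) ->
  increasing_vec alpha -> increasing_vec gamma ->
  (forall i, alpha 0 i <= gamma 0 i) -> alpha != gamma ->
  forall i, Omega alpha beta 0 i < Omega gamma beta 0 i.
Proof.
move=> hb ha hg ag neq.
(* Entries of [gamma] are lowered to those of [alpha] from the left, so that
   [alpha i < alpha j <= gamma j] keeps every stage strictly increasing. *)
pose mix k : 'rV[R]_n := \row_i (if (i < k)%N then alpha 0 i else gamma 0 i).
have mixinc k : increasing_vec (mix k).
  move=> i j ij; rewrite !mxE; case: (ltnP i k) => ik; case: (ltnP j k) => jk.
  - exact: ha.
  - exact: lt_le_trans (ha _ _ ij) (ag j).
  - by have := leq_trans (ltn_trans ij jk) ik; rewrite ltnn.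
  - exact: hg.
have mix0 : mix 0%N = gamma by apply/rowP => i; rewrite mxE.
have mixn : mix n = alpha by apply/rowP => i; rewrite mxE ltn_ord.
have step k : (k < n)%N -> mix k.+1 = mix k \/
    forall i, Omega (mix k.+1) beta 0 i < Omega (mix k) beta 0 i.
  move=> kn; pose i0 := Ordinal kn.
  have off i : i != i0 -> mix k.+1 0 i = mix k 0 i.
    move=> ii0; rewrite !mxE ltnS leq_eqVlt; case: eqP => // e.
    by case/eqP: ii0; exact: val_inj.
  have := ag i0; rewrite le_eqVlt => /predU1P[e|lt0]; [left|right].
    apply/rowP => i; have [->|] := eqVneq i i0; last exact: off.
    by rewrite !mxE /= ltnSn ltnn.
  by apply: Omega_step off _ => //; rewrite !mxE /= ltnSn ltnn.
have le_mix k : (k <= n)%N -> mix k = mix 0%N \/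
    forall i, Omega (mix k) beta 0 i < Omega (mix 0%N) beta 0 i.
  elim: k => [|k IH] kn; first by left.
  have [e|h] := IH (ltnW kn); have [e'|h'] := step k kn.
  - by left; rewrite e'.
  - by right => i; rewrite -e.
  - by right => i; rewrite e'.
  - by right => i; exact: lt_trans (h i).
by have := le_mix n (leqnn _); rewrite mix0 mixn => -[e|//]; rewrite e eqxx in neq.
Qed.

End Vectors.
End OmegaTheory.

(** * Majorization and contraction *)

Section Majorization.
Variable R : realType.

(** Abel summation as an induction: the last [x k] times the partial sum of [d] bounds the weighted
    sum from below, and lowering [x k] to [x (k+1)] preserves this because partial sums are
    nonnegative. *)
Lemma abel_sum_ge0 n (x d : nat -> R) :
  (forall i, (i.+1 < n)%N -> x i.+1 <= x i) ->
  (forall k, (k <= n)%N -> 0 <= \sum_(0 <= i < k) d i) ->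
  \sum_(0 <= i < n) d i = 0 -> 0 <= \sum_(0 <= i < n) x i * d i.
Proof.
case: n => [|n] xd dge0 d0; first by rewrite big_geq.
suff h k : (k < n.+1)%N ->
    x k * \sum_(0 <= i < k.+1) d i <= \sum_(0 <= i < k.+1) x i * d i.
  by have := h n (leqnn _); rewrite d0 mulr0.
elim: k => [|k IH] kn; first by rewrite !big_nat1.
rewrite !(big_nat_recr k.+1)//= mulrDr lerD2r.
apply: le_trans (IH (ltnW kn)); rewrite ler_wpM2r ?xd//.
by apply: dge0; exact: ltnW.
Qed.

(* Karamata's inequality for the square: once both families are sorted decreasingly,
   Abel summation gives [sum x_i (y_i - x_i) >= 0], so that
   [sum y_i^2 - sum x_i^2 >= sum (y_i - x_i)^2 >= (y_0 - x_0)^2 > 0]. *)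
Lemma sum_sqr_lt_of_majorization (s t : seq R) (y0 : R) : size s = size t ->
  \sum_(x <- s) x = \sum_(y <- t) y ->
  (forall c, \sum_(x <- s) Num.max (x - c) 0 <= \sum_(y <- t) Num.max (y - c) 0) ->
  y0 \in t -> {in s, forall x, x < y0} ->
  \sum_(x <- s) x ^+ 2 < \sum_(y <- t) y ^+ 2.
Proof.
wlog [ss st] : s t / sorted >=%R s /\ sorted >=%R t.
  move=> H; have ps := permEl (perm_sort >=%R s); have pt := permEl (perm_sort >=%R t).
  move=> h1 h2 h3 h4 h5.
  rewrite -(perm_big _ ps) -(perm_big _ pt) /=; apply: H => //.
  - by split; apply: sort_sorted => x y; exact: le_total.
  - by rewrite !size_sort.
  - by rewrite (perm_big _ ps) (perm_big _ pt).
  - by move=> c; rewrite (perm_big _ ps) (perm_big _ pt) /=; exact: h3.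
  - by rewrite mem_sort.
  - by move=> x; rewrite mem_sort; exact: h5.
move=> hst h1 h2 y0t hs.
have n0 : (0 < size t)%N by case: t y0t {st hst h1 h2}.
move: h1 h2; set n := size t in hst n0 *.
pose x i := nth 0 s i; pose y i := nth 0 t i.
have sE (F : R -> R) : \sum_(z <- s) F z = \sum_(0 <= i < n) F (x i) by rewrite (big_nth 0) hst.
have tE (F : R -> R) : \sum_(z <- t) F z = \sum_(0 <= i < n) F (y i) by rewrite (big_nth 0).
rewrite (sE id) (tE id) (sE (fun z => z ^+ 2)) (tE (fun z => z ^+ 2)) => h1 h2.
have {}h2 c : \sum_(0 <= i < n) Num.max (x i - c) 0 <= \sum_(0 <= i < n) Num.max (y i - c) 0.
  by rewrite -(sE (fun z => Num.max (z - c) 0)) -(tE (fun z => Num.max (z - c) 0)).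
have ge_trans : transitive (>=%R : rel R) by move=> a b c ba cb; exact: le_trans cb ba.
have ge_refl : reflexive (>=%R : rel R) by move=> a; exact: lexx.
have yd i j : (i <= j)%N -> (j < n)%N -> y j <= y i.
  move=> ij jn; have := sorted_leq_nth ge_trans ge_refl 0 st.
  by apply => //; rewrite inE// (leq_ltn_trans ij).
have xd i : (i.+1 < n)%N -> x i.+1 <= x i.
  move=> im; have := sorted_leq_nth ge_trans ge_refl 0 ss.
  by apply => //; rewrite inE hst// ltnW.
have part k : (k <= n)%N -> \sum_(0 <= i < k) x i <= \sum_(0 <= i < k) y i.
  case: k => [|k] kn; first by rewrite !big_geq.
  (* With the smallest of the [k + 1] largest entries of [t] as threshold, the positive parts of
     [y i - c] add up to exactly the sum over these entries. *)
  pose c := y k.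
  suff : \sum_(0 <= i < k.+1) (x i - c) <= \sum_(0 <= i < k.+1) (y i - c).
    by rewrite !sumrB lerD2r.
  have -> : \sum_(0 <= i < k.+1) (y i - c) = \sum_(0 <= i < n) Num.max (y i - c) 0.
    rewrite [RHS](big_cat_nat (n := k.+1))//= [X in _ = _ + X]big1_seq ?addr0 => [|i].
      apply: eq_big_nat => i /andP[_ ik]; apply/esym/max_idPl; rewrite subr_ge0.
      by apply: yd => //.
    rewrite mem_index_iota => /andP[_ /andP[ki im]]; apply/max_idPr; rewrite subr_le0.
    by apply: yd => //; exact: ltnW.
  apply: le_trans (h2 c); rewrite [leRHS](big_cat_nat (n := k.+1))//=.
  rewrite -[leLHS]addr0 lerD//; first by apply: ler_sum => i _; rewrite le_max lexx.
  by apply: sumr_ge0 => i _; rewrite le_max lexx orbT.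
have abel := @abel_sum_ge0 n x (fun i => y i - x i) xd.
have {}abel : 0 <= \sum_(0 <= i < n) x i * (y i - x i).
  apply: abel => [k kn|]; first by rewrite sumrB subr_ge0 part.
  by rewrite sumrB h1 subrr.
rewrite -subr_gt0 -sumrB.
rewrite (eq_bigr (fun i => (y i - x i) ^+ 2 + 2 * (x i * (y i - x i)))); last first.
  by move=> i _; ring.
rewrite big_split /= -mulr_sumr ltr_wpDr//; first by rewrite mulr_ge0.
rewrite big_ltn// ltr_pwDl//; last by apply: sumr_ge0 => i _; exact: sqr_ge0.
rewrite exprn_even_gt0//= subr_eq0 gt_eqF//.
apply: (@lt_le_trans _ _ y0); first by rewrite hs// mem_nth// hst.
have := y0t => /(nthP 0)[j jt <-]; exact: yd.
Qed.

Section Contraction.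
Variable m : nat.
Local Notation n := m.+1.
Implicit Types (alpha beta gamma z : 'rV[R]_n).

Lemma centered_sub alpha gamma :
  centered alpha - centered gamma = centered (alpha - gamma).
Proof.
have mB : vec_mean (alpha - gamma) = vec_mean alpha - vec_mean gamma.
  by rewrite /vec_mean -mulrBr -sumrB; congr (_ * _); apply: eq_bigr => i _; rewrite !mxE.
by rewrite /centered mB; apply/rowP => i; rewrite !mxE; ring.
Qed.

Lemma sum_sqr_centered z :
  \sum_i centered z 0 i ^+ 2 = \sum_i z 0 i ^+ 2 - n%:R^-1 * (\sum_i z 0 i) ^+ 2.
Proof.
rewrite (eq_bigr (fun i => z 0 i ^+ 2 +
  ((- 2 * vec_mean z) * z 0 i + vec_mean z ^+ 2))); last first.
  by move=> i _; rewrite !mxE; ring.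
rewrite !big_split /= -mulr_sumr sumr_const card_ord -[_ *+ n]mulr_natr /vec_mean.
have nz : n%:R != 0 :> R by rewrite pnatr_eq0.
by field; rewrite addrC natr1.
Qed.

(** Centering lowers a sum of squares by the squared sum over [n], and this amount is the same on
    both sides. *)
Lemma d2_lt alpha alpha' gamma gamma' :
  \sum_i (alpha - alpha') 0 i = \sum_i (gamma - gamma') 0 i ->
  \sum_i (alpha - alpha') 0 i ^+ 2 < \sum_i (gamma - gamma') 0 i ^+ 2 ->
  d2 alpha alpha' < d2 gamma gamma'.
Proof.
move=> h1 h2; rewrite /d2 /norm2 !centered_sub.
have h3 : \sum_i centered (alpha - alpha') 0 i ^+ 2 < \sum_i centered (gamma - gamma') 0 i ^+ 2.
  by rewrite !sum_sqr_centered h1 ltrD2r.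
by rewrite ltr_sqrt// (le_lt_trans _ h3)// sumr_ge0// => i _; exact: sqr_ge0.
Qed.

(* Crandall-Tartar: for [gamma := max (alpha, alpha' + c)], monotonicity and
   equivariance give [max (D - c, 0) <= Omega gamma - Omega alpha' - c] with
   [D := Omega alpha - Omega alpha'], and the sums of the right-hand sides are
   preserved by [Omega]; hence [D] is majorized by [alpha - alpha']. *)
Lemma Omega_contraction alpha alpha' beta : ~~ constant (entries beta) ->
  increasing_vec alpha -> increasing_vec alpha' ->
  centered alpha <> centered alpha' ->
  d2 (Omega alpha beta) (Omega alpha' beta) < d2 alpha alpha'.
Proof.
move=> hb ha ha' hc.
have mono a g : increasing_vec a -> increasing_vec g -> (forall i, a 0 i <= g 0 i) ->
    forall i, Omega a beta 0 i <= Omega g beta 0 i.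
  move=> ia ig ag i; have [->//|neq] := eqVneq a g.
  exact/ltW/Omega_strict_mono.
have shift_inc c : increasing_vec (alpha' + const_mx c).
  by move=> i j ij; rewrite !mxE ltrD2r ha'.
apply: d2_lt.
  under eq_bigr do rewrite !mxE; under [RHS]eq_bigr do rewrite !mxE.
  by rewrite !sumrB !Omega_sum//; ring.
pose D := Omega alpha beta - Omega alpha' beta; pose delta := alpha - alpha'.
pose i0 : 'I_n := [arg max_(i > ord0) delta 0 i]%O.
have i0P i : delta 0 i <= delta 0 i0 by rewrite /i0; case: arg_maxP => //= k _ /(_ i isT).
have h := @sum_sqr_lt_of_majorization (entries D) (entries delta) (delta 0 i0).
have sumE (z : 'rV[R]_n) (F : R -> R) : \sum_(x <- entries z) F x = \sum_i F (z 0 i).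
  by rewrite big_map big_enum.
rewrite (sumE D (fun x => x ^+ 2)) (sumE delta (fun x => x ^+ 2)) in h.
apply: h.
- by rewrite !size_entries.
- rewrite !sum_entries; under eq_bigr do rewrite !mxE.
  by under [RHS]eq_bigr do rewrite !mxE; rewrite !sumrB !Omega_sum//; ring.
- move=> c; rewrite (sumE D (fun x => Num.max (x - c) 0)) (sumE delta (fun x => Num.max (x - c) 0)).
  pose gamma : 'rV[R]_n := \row_i Num.max (alpha 0 i) (alpha' 0 i + c).
  have hg : increasing_vec gamma.
    move=> i j ij; rewrite !mxE lt_max !gt_max.
    have := ha _ _ ij; have := ha' _ _ ij.
    by case: (leP (alpha 0 j) (alpha' 0 j + c)) => h2 h3 h4;
      apply/orP; [right|left]; apply/andP; split; lra.
  have g1 := mono _ _ ha hg; have g2 := mono _ _ (shift_inc c) hg.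
  apply: (@le_trans _ _ (\sum_i (Omega gamma beta 0 i - Omega alpha' beta 0 i - c))).
    apply: ler_sum => i _; rewrite ge_max !mxE; apply/andP; split.
      by rewrite !lerD2r g1// => k; rewrite mxE le_max lexx.
    rewrite -addrA -opprD subr_ge0 (_ : _ + c = Omega (alpha' + const_mx c) beta 0 i).
      by apply: g2 => k; rewrite !mxE le_max lexx orbT.
    by rewrite Omega_shift// !mxE.
  rewrite (_ : \sum_i (_ - c) = \sum_i (gamma 0 i - alpha' 0 i - c)); last first.
    by rewrite !sumrB !Omega_sum//; ring.
  apply: ler_sum => i _; rewrite !mxE.
  by case: (leP (alpha 0 i) (alpha' 0 i + c)) => h; rewrite le_max; lra.
- by apply: map_f; rewrite mem_enum.
move=> _ /mapP[i _ ->].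
(* Translating [alpha'] by the maximal difference dominates [alpha]; equality would make the two
   centered vectors agree. *)
suff : Omega alpha beta 0 i < Omega (alpha' + const_mx (delta 0 i0)) beta 0 i.
  by rewrite Omega_shift// !mxE ltrBlDl.
apply: Omega_strict_mono => //.
  by move=> k; have := i0P k; rewrite !mxE; lra.
apply/eqP; move: (delta 0 i0) => d e; apply: hc; apply/eqP.
rewrite -subr_eq0 centered_sub e addrC addKr.
apply/eqP/rowP => k; rewrite !mxE /vec_mean (eq_bigr (fun=> d)) => [|j _]; last by rewrite mxE.
by rewrite sumr_const card_ord -[d *+ _]mulr_natl mulKf ?pnatr_eq0// subrr.
Qed.

End Contraction.
End Majorization.

(** * Wasserstein distance of empirical measures *)

Section EmpiricalWasserstein.
Local Open Scope classical_set_scope.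
Variables (R : realType) (m : nat).
Local Notation n := m.+1.
Local Notation bR := (measurableTypeR R).
Implicit Types (x y : 'rV[R]_n).

Lemma empirical_counting x (A : set bR) :
  empirical x A = (n%:R^-1 * \sum_i (x 0 i \in A)%:R)%:E.
Proof.
by rewrite /empirical EFinM -sumEFin; congr (_ * _)%E.
Qed.

Lemma empirical_set1 x i : injective (x 0) ->
  empirical x [set x 0 i] = (n%:R^-1)%:E.
Proof.
move=> xi; rewrite empirical_counting (bigD1 i)//= big1 ?addr0 => [|j ji].
  by rewrite mem_set// mulr1.
by rewrite memNset//= => /xi/eqP; exact/negP.
Qed.

Lemma same_measure_empirical_inj x y : increasing_vec x -> increasing_vec y ->
  same_measure (empirical x) (empirical y) -> x = y.
Proof.
move=> xi yi h; apply: poly_of_roots_inj; try exact: increasing_nondecreasing.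
rewrite !poly_of_rootsE; apply: perm_big.
have sub x' y' : increasing_vec x' -> same_measure (empirical x') (empirical y') ->
    {subset entries x' <= entries y'}.
  move=> xi' h' _ /mapP[i _ ->].
  have /(_ (measurable_set1 _)) := h' [set x' 0 i].
  rewrite [LHS]empirical_set1; last exact: increasing_vec_inj.
  rewrite [RHS]empirical_counting => -[].
  case: (boolP (_ \in _)) => // nin; rewrite big1 => [|j _].
    by rewrite mulr0 => /eqP; rewrite invr_eq0 pnatr_eq0.
  rewrite memNset//= => e; case/negP: nin; rewrite -e.
  by apply: map_f; rewrite mem_enum.
apply: uniq_perm => [||a].
- by rewrite map_inj_uniq ?enum_uniq//; exact: increasing_vec_inj.
- by rewrite map_inj_uniq ?enum_uniq//; exact: increasing_vec_inj.
by apply/idP/idP; apply: sub => // A mA; rewrite h.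
Qed.

Lemma measurable_sqr_dist :
  measurable_fun setT ((fun z => (((z.1 : R) - (z.2 : R)) ^+ 2)%:E) : bR * bR -> \bar R).
Proof.
apply: measurableT_comp => //; apply: measurable_funX.
by apply: measurable_funB; [exact: measurable_fst|exact: measurable_snd].
Qed.

Lemma W2_empirical_le x y :
  (W2 (empirical x) (empirical y) <=
   sqrte (n%:R^-1 * \sum_i (x 0 i - y 0 i) ^+ 2)%:E)%E.
Proof.
have c0 : 0 <= n%:R^-1 * \sum_i (x 0 i - y 0 i) ^+ 2.
  by rewrite mulr_ge0// sumr_ge0// => i _; exact: sqr_ge0.
rewrite /W2 lee_sqrt ?lee_fin//; apply: ereal_inf_lbound.
(* The monotone coupling puts mass [1/n] on each pair of entries with equal index; [inord] is there
   because [msum] is indexed by [nat]. *)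
pose D k : {measure set (bR * bR) -> \bar R} :=
  \d_((x 0 (inord k) : bR, y 0 (inord k) : bR)).
have n1 : 0 <= n%:R^-1 :> R by rewrite invr_ge0.
pose pi0 : {measure set (bR * bR) -> \bar R} := mscale (NngNum n1) (msum D n).
exists pi0.
  split=> [A mA|B mB]; rewrite /pi0 /= /mscale /msum /= /empirical; congr (_ * _)%E;
    apply: eq_bigr => i _; rewrite /D !diracE inord_val; congr (_%:R%:E).
    by rewrite in_setX in_setT andbT.
  by rewrite in_setX in_setT.
rewrite ge0_integral_mscale//=; last 2 first.
- exact: measurable_sqr_dist.
- by move=> z _; rewrite lee_fin sqr_ge0.
rewrite ge0_integral_measure_sum//; last 2 first.
- by move=> z _; rewrite lee_fin sqr_ge0.
- exact: measurable_sqr_dist.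
rewrite EFinM -sumEFin; congr (_ * _)%E; apply: eq_bigr => i _.
rewrite integral_dirac//; last exact: measurable_sqr_dist.
by rewrite diracT mul1e /= inord_val.
Qed.

(* Dual potentials of the monotone coupling; [a] is a discrete
   primitive of [y] with respect to [x]. *)
Lemma monotone_potential x y : nondecreasing_vec x -> nondecreasing_vec y ->
  exists a : 'I_n -> R, forall i j, (x 0 i - x 0 j) * y 0 j <= a i - a j.
Proof.
move=> xi yi; pose X k := x 0 (inord k); pose Y k := y 0 (inord k).
have incr (z : 'rV[R]_n) : nondecreasing_vec z -> forall k l, (k <= l < n)%N ->
    z 0 (inord k) <= z 0 (inord l).
  by move=> zi k l /andP[kl ln]; apply: zi; rewrite !inordK// (leq_ltn_trans kl).
have Xi := incr x xi; have Yi := incr y yi.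
pose A k := \sum_(0 <= l < k) (X l.+1 - X l) * Y l.
have AS k : A k.+1 = A k + (X k.+1 - X k) * Y k by rewrite /A big_nat_recr.
have up j d : (j + d < n)%N -> (X (j + d)%N - X j) * Y j <= A (j + d)%N - A j.
  elim: d => [|d IH]; first by rewrite addn0 !subrr mul0r.
  rewrite addnS => jd; have := IH (ltnW jd); rewrite AS.
  have h1 : X (j + d)%N <= X (j + d).+1 by apply: Xi; rewrite leqnSn.
  have h2 : Y j <= Y (j + d)%N by apply: Yi; rewrite leq_addr ltnW.
  have : 0 <= (X (j + d).+1 - X (j + d)%N) * (Y (j + d)%N - Y j) by rewrite mulr_ge0 ?subr_ge0.
  nra.
have down j d : (j + d < n)%N -> (X j - X (j + d)%N) * Y (j + d)%N <= A j - A (j + d)%N.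
  elim: d => [|d IH]; first by rewrite addn0 !subrr mul0r.
  rewrite addnS => jd; have := IH (ltnW jd); rewrite AS.
  have h1 : X j <= X (j + d).+1 by apply: Xi; rewrite jd andbT -addnS leq_addr.
  have h2 : Y (j + d)%N <= Y (j + d).+1 by apply: Yi; rewrite leqnSn.
  have : 0 <= (X (j + d).+1 - X j) * (Y (j + d).+1 - Y (j + d)%N) by rewrite mulr_ge0 ?subr_ge0.
  nra.
exists (fun i => A i) => i j.
have XE k : x 0 k = X k by rewrite /X inord_val.
rewrite !XE (_ : y 0 j = Y j); last by rewrite /Y inord_val.
case: (leqP j i) => [ji|/ltnW ij].
  by have := up j (i - j)%N; rewrite subnKC//; apply; exact: ltn_ord.
by have := down i (j - i)%N; rewrite subnKC//; apply; exact: ltn_ord.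
Qed.

(** Kantorovich duality: [u i + v j <= (x i - y j)^2] by the choice of potentials, with equality for
    [i = j], and the total of [u i + v j] depends only on the marginals of [w]. *)
Lemma monotone_assignment_le x y (w : 'I_n -> 'I_n -> R) :
  nondecreasing_vec x -> nondecreasing_vec y ->
  (forall i j, 0 <= w i j) ->
  (forall i, \sum_j w i j = n%:R^-1) -> (forall j, \sum_i w i j = n%:R^-1) ->
  n%:R^-1 * \sum_i (x 0 i - y 0 i) ^+ 2 <=
  \sum_i \sum_j (x 0 i - y 0 j) ^+ 2 * w i j.
Proof.
move=> xi yi w0 wr wc; have [a ha] := monotone_potential xi yi.
pose u i := x 0 i ^+ 2 - 2 * a i.
pose v j := y 0 j ^+ 2 - 2 * (x 0 j * y 0 j - a j).
apply: (@le_trans _ _ (\sum_i \sum_j (u i + v j) * w i j)); last first.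
  apply: ler_sum => i _; apply: ler_sum => j _; rewrite ler_wpM2r//.
  by have := ha i j; rewrite /u /v; nra.
rewrite le_eqVlt; apply/orP; left; apply/eqP.
transitivity (\sum_i u i * n%:R^-1 + \sum_j v j * n%:R^-1).
  rewrite mulr_sumr -big_split; apply: eq_bigr => i _ /=.
  by rewrite /u /v; ring.
under eq_bigr => i _ do rewrite -(wr i) mulr_sumr.
under [X in _ + X]eq_bigr => j _ do rewrite -(wc j) mulr_sumr.
rewrite [X in _ + X]exchange_big -big_split; apply: eq_bigr => i _ /=.
by rewrite -big_split /=; apply: eq_bigr => j _; rewrite [RHS]mulrDl.
Qed.

Lemma bigsetU_ordP (T : Type) (G : 'I_n -> set T) z :
  (\big[setU/set0]_(j < n) G j) z <-> exists j, G j z.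
Proof.
rewrite -bigcup_seq; split=> [[j _ Gz]|[j Gz]]; exists j => //=.
by rewrite mem_index_enum.
Qed.

Lemma measure_split_ord (pi : {measure set (bR * bR) -> \bar R})
    (S : set (bR * bR)) (G : 'I_n -> set (bR * bR)) :
  measurable S -> (forall j, measurable (G j)) -> trivIset setT G ->
  pi (~` \big[setU/set0]_(j < n) G j) = 0%E ->
  (\sum_j pi (S `&` G j) = pi S)%E.
Proof.
move=> mS mG tG G0; set U := \big[setU/set0]_(j < n) G j in G0 *.
have mU : measurable U by apply: bigsetU_measurable => j _; exact: mG.
have SE : S = (\big[setU/set0]_(j < n) (S `&` G j)) `|` (S `\` U).
  apply/seteqP; split=> [z Sz|z [/bigsetU_ordP[j []]//|[]//]].
  have [/bigsetU_ordP[j Gz]|nU] := pselect (U z); last by right.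
  by left; apply/bigsetU_ordP; exists j.
have mSG j : measurable (S `&` G j) by exact: measurableI.
rewrite [in RHS]SE measureU; last 3 first.
- exact: bigsetU_measurable.
- exact: measurableD.
- by apply/seteqP; split=> // z [/bigsetU_ordP[j [_ Gz]] [_]]; apply; apply/bigsetU_ordP; exists j.
rewrite measure_bigsetU_ord//; last first.
  apply/trivIsetP => i j _ _ ij; apply/seteqP; split=> // z [[_ Gi] [_ Gj]].
  have /trivIsetP/(_ i j I I ij) GI := tG.
  by have : (G i `&` G j) z by []; rewrite GI.
rewrite -[LHS]adde0; congr (_ + _)%E; apply/esym/eqP.
rewrite -measure_le0 -G0; apply: le_measure; rewrite ?inE//.
- exact: measurableD.
- exact: measurableC.
Qed.

Lemma empirical_support x : empirical x (~` \big[setU/set0]_(j < n) [set x 0 j]) = 0%E.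
Proof.
rewrite empirical_counting big1 ?mulr0// => i _.
by rewrite memNset//= => h; apply: h; apply/bigsetU_ordP; exists i.
Qed.

(** The masses that a coupling gives to the pairs [(x i, y j)] form a matrix with row and column
    sums [1/n], which reduces the bound to the discrete problem. Distinct entries keep these atoms
    disjoint. *)
Lemma W2_empirical_ge x y : increasing_vec x -> increasing_vec y ->
  (sqrte (n%:R^-1 * \sum_i (x 0 i - y 0 i) ^+ 2)%:E <=
   W2 (empirical x) (empirical y))%E.
Proof.
move=> xi yi; rewrite /W2 lee_sqrt; last first.
  by apply: le_ereal_inf_tmp => _ [pi _ <-]; apply: integral_ge0 => z _; rewrite lee_fin sqr_ge0.
apply: le_ereal_inf_tmp => _ [pi [pi1 pi2] <-].
have xinj := increasing_vec_inj xi; have yinj := increasing_vec_inj yi.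
pose atom (i j : 'I_n) : set (bR * bR) := [set (x 0 i : bR)] `*` [set (y 0 j : bR)].
have matom i j : measurable (atom i j) by apply: measurableX; exact: measurable_set1.
have mset1 (z : 'rV[R]_n) : measurable (~` \big[setU/set0]_(j < n) [set (z 0 j : bR)]).
  by apply: measurableC; apply: bigsetU_measurable => j _; exact: measurable_set1.
(* The vertical line over [x 0 i] is split by second coordinate; what remains is null by the second
   marginal. *)
have row i : (\sum_j pi (atom i j) = (n%:R^-1)%:E)%E.
  rewrite -(empirical_set1 i xinj) -pi1; last exact: measurable_set1.
  rewrite -(measure_split_ord (G := fun j => setT `*` [set (y 0 j : bR)])).
  - apply: eq_bigr => j _; congr (pi _).
    by apply/seteqP; split=> [z [zx zy]|z [[zx _] [_ zy]]]; split; try split.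
  - by apply: measurableX => //; exact: measurable_set1.
  - by move=> j; apply: measurableX => //; exact: measurable_set1.
  - apply/trivIsetP => j k _ _ jk; apply/seteqP; split=> // z [[_ /= zj] [_ /= zk]].
    by case/eqP: jk; apply: yinj; rewrite -zj -zk.
  rewrite -(empirical_support y) -pi2//; congr (pi _).
  apply/seteqP; split=> z.
    by move=> h; split=> // /bigsetU_ordP[j zj]; apply: h; apply/bigsetU_ordP; exists j.
  by move=> [_ h] /bigsetU_ordP[j [_ zj]]; apply: h; apply/bigsetU_ordP; exists j.
have col j : (\sum_i pi (atom i j) = (n%:R^-1)%:E)%E.
  rewrite -(empirical_set1 j yinj) -pi2; last exact: measurable_set1.
  rewrite -(measure_split_ord (G := fun i => [set (x 0 i : bR)] `*` setT)).
  - apply: eq_bigr => i _; congr (pi _).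
    by apply/seteqP; split=> [z [zx zy]|z [[_ zy] [zx _]]]; split; try split.
  - by apply: measurableX => //; exact: measurable_set1.
  - by move=> i; apply: measurableX => //; exact: measurable_set1.
  - apply/trivIsetP => i k _ _ ik; apply/seteqP; split=> // z [[/= zi _] [/= zk _]].
    by case/eqP: ik; apply: xinj; rewrite -zi -zk.
  rewrite -(empirical_support x) -pi1//; congr (pi _).
  apply/seteqP; split=> z.
    by move=> h; split=> // /bigsetU_ordP[i zi]; apply: h; apply/bigsetU_ordP; exists i.
  by move=> [h _] /bigsetU_ordP[i [zi _]]; apply: h; apply/bigsetU_ordP; exists i.
have fin i j : pi (atom i j) \is a fin_num.
  rewrite ge0_fin_numE//; apply: (@le_lt_trans _ _ (n%:R^-1)%:E); last exact: ltry.
  by rewrite -(row i) (bigD1 j)//= leeDl// sume_ge0.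
pose w i j := fine (pi (atom i j)).
have wE i j : pi (atom i j) = (w i j)%:E by rewrite fineK.
have h := @monotone_assignment_le x y w (increasing_nondecreasing xi) (increasing_nondecreasing yi).
apply: (@le_trans _ _ (\sum_i \sum_j (x 0 i - y 0 j) ^+ 2 * w i j)%:E).
  rewrite lee_fin; apply: h => [i j|i|j].
  - by rewrite fine_ge0.
  - by have := row i; under eq_bigr do rewrite wE; rewrite sumEFin => -[].
  - by have := col j; under eq_bigr do rewrite wE; rewrite sumEFin => -[].
(* The sum of these functions is the cost on the atoms and 0 elsewhere: a minorant of the cost whose
   integral is the discrete sum. *)
pose step (ij : 'I_n * 'I_n) (z : bR * bR) : \bar R :=
  (((x 0 ij.1 - y 0 ij.2) ^+ 2)%:E * (\1_(atom ij.1 ij.2) z)%:E)%E.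
have step0 ij z : (0 <= step ij z)%E by rewrite mule_ge0// lee_fin ?sqr_ge0.
have mind ij : measurable_fun setT (fun z => (\1_(atom ij.1 ij.2) z)%:E : \bar R).
  by apply: measurableT_comp => //; exact: measurable_indic.
have mstep ij : measurable_fun setT (step ij) by exact: measurable_funeM.
have -> : (\sum_i \sum_j (x 0 i - y 0 j) ^+ 2 * w i j)%:E =
    (\int[pi]_z (\sum_(ij <- index_enum ('I_n * 'I_n)%type) step ij z))%E.
  rewrite ge0_integral_sum// pair_big -sumEFin; apply: eq_bigr => ij _ /=.
  rewrite ge0_integralZl_EFin ?sqr_ge0//.
  by rewrite integral_indic// setIT EFinM -wE.
apply: ge0_le_integral => //.
- by move=> z _; apply: sume_ge0.
- by apply: emeasurable_sum.
- exact: measurable_sqr_dist.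
move=> z _.
have [[[i j] zij]|nz] := pselect (exists ij, atom ij.1 ij.2 z).
  have [/= zi zj] := zij.
  rewrite (bigD1 (i, j))//= big1 ?adde0 => [|[k l] /eqP kl].
    by rewrite /step /= indicE mem_set// mule1 zi zj.
  rewrite /step indicE memNset ?mule0// => -[/= zk zl]; apply: kl.
  by congr (_, _); [apply: xinj; rewrite -zi|apply: yinj; rewrite -zj].
rewrite big1 ?lee_fin ?sqr_ge0// => ij _; rewrite /step indicE memNset ?mule0//.
by move=> zij; apply: nz; exists ij.
Qed.

End EmpiricalWasserstein.

(** * Point masses, and passage from [d2] to [W2] *)

Section PointMass.
Variables (R : realType) (m : nat).
Local Notation n := m.+1.
Local Notation conv := (@finite_free_conv R).
Local Notation P s := (\prod_(x <- s) ('X - x%:P)).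
Implicit Types (alpha beta : 'rV[R]_n).

Lemma not_point_mass_nonconstant beta :
  ~ point_mass n (poly_of_roots beta) -> ~~ constant (entries beta).
Proof.
move=> h; apply/negP => /(constantP 0)[b e]; apply: h; exists b.
by rewrite poly_of_rootsE e size_entries big_nseq iter_mulr_1.
Qed.

Lemma conv_point_mass alpha b :
  conv n (poly_of_roots alpha) (('X - b%:P) ^+ n) = poly_of_roots (alpha + const_mx b).
Proof.
have -> : ('X - b%:P) ^+ n = P (nseq (size (entries alpha)) b).
  by rewrite big_nseq iter_mulr_1 size_entries.
rewrite poly_of_rootsE -{1}(size_entries alpha) conv_prod_nseq poly_of_rootsE -map_comp.
by congr (\prod_(x <- _) _); apply: eq_map => i; rewrite /= !mxE.
Qed.

Lemma centered_shift alpha b : centered (alpha + const_mx b) = centered alpha.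
Proof.
apply/rowP => i; rewrite !mxE /vec_mean (eq_bigr (fun i => alpha 0 i + b)) => [|j _];
  last by rewrite !mxE.
rewrite big_split /= sumr_const card_ord -[b *+ _]mulr_natl mulrDr mulKf ?pnatr_eq0//.
by ring.
Qed.

Lemma centered_increasing alpha : increasing_vec alpha -> increasing_vec (centered alpha).
Proof. by move=> ai i j ij; rewrite !mxE ltrD2r ai. Qed.

Lemma simple_polyP (p : {poly R}) : simple_poly n p ->
  exists2 alpha : 'rV[R]_n, increasing_vec alpha & p = poly_of_roots alpha.
Proof.
move=> [r [ri ->]]; have [|l] := @rootpoly_of_uniq _ (entries r).
  by rewrite map_inj_uniq ?enum_uniq.
rewrite size_entries => li e; exists (\row_(i < n) l i).
  by move=> i j ij; rewrite !mxE; exact: li.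
by rewrite poly_of_rootsE e rootpoly_row.
Qed.

Lemma centered_empirical_poly_of_roots alpha : increasing_vec alpha ->
  centered_empirical n (poly_of_roots alpha) = empirical (centered alpha).
Proof.
move=> ai; rewrite /centered_empirical root_vec_poly_of_roots//.
exact: increasing_nondecreasing.
Qed.

(** The smaller side is bounded above by an explicit coupling, the larger one below by optimality;
    both bounds are [norm2] divided by the square root of [n]. *)
Lemma lt_W2_empirical (x y x' y' : 'rV[R]_n) :
  increasing_vec x' -> increasing_vec y' ->
  norm2 (x - y) < norm2 (x' - y') ->
  (W2 (empirical x) (empirical y) < W2 (empirical x') (empirical y'))%E.
Proof.
move=> xi yi lt_norm; apply: le_lt_trans (W2_empirical_le x y) _.
apply: lt_le_trans (W2_empirical_ge xi yi).
have sumE (u v : 'rV[R]_n) : \sum_i (u 0 i - v 0 i) ^+ 2 = \sum_i (u - v) 0 i ^+ 2.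
  by apply: eq_bigr => i _; rewrite !mxE.
rewrite ltNge lee_sqrt -?ltNge; last first.
  by rewrite lee_fin mulr_ge0// sumr_ge0// => i _; exact: sqr_ge0.
rewrite lte_fin ltr_pM2l ?invr_gt0 ?ltr0n// !sumE ltNge; apply: contraL lt_norm => le_sq.
by rewrite -leNgt; exact: ler_wsqrtr.
Qed.

End PointMass.

Theorem theorem5p3 (R : realType) (n : nat) (beta : 'rV[R]_n) (q : {poly R})
    (hn : (2 <= n)%N) (hq : q = poly_of_roots beta) :
  ((forall alpha alpha' : 'rV[R]_n,
      increasing_vec alpha -> increasing_vec alpha' ->
      centered alpha <> centered alpha' ->
      d2 (Omega alpha beta) (Omega alpha' beta) < d2 alpha alpha')
   <-> ~ point_mass n q)
  /\
  ((forall p p' : {poly R},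
      simple_poly n p -> simple_poly n p' ->
      ~ same_measure (centered_empirical n p) (centered_empirical n p') ->
      (W2 (centered_empirical n (finite_free_conv n p q))
          (centered_empirical n (finite_free_conv n p' q))
       < W2 (centered_empirical n p) (centered_empirical n p'))%E)
   <-> ~ point_mass n q).
Proof.
case: n => // m in beta hn hq *.
(* A simple configuration and its dilation by 2 differ modulo translation because [n >= 2]; this
   pair refutes strict contraction for a point mass. *)
pose a : 'rV[R]_m.+1 := \row_i (i : nat)%:R; pose a' : 'rV[R]_m.+1 := \row_i (2 * (i : nat)%:R).
have ai : increasing_vec a by move=> i j ij; rewrite !mxE ltr_nat.
have a'i : increasing_vec a' by move=> i j ij; rewrite !mxE ltr_pM2l// ltr_nat.
have aa' : centered a <> centered a'.
  move=> /rowP e; have := e 0; have := e (Ordinal hn).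
  by rewrite !mxE /=; lra.
split; split.
- move=> h [b qb]; have := h a a' ai a'i aa'.
  have OE alpha : increasing_vec alpha -> Omega alpha beta = alpha + const_mx b.
    move=> ali; rewrite /Omega -hq qb conv_point_mass root_vec_poly_of_roots//.
    by apply: increasing_nondecreasing => i j ij; rewrite !mxE ltrD2r ali.
  by rewrite !OE// /d2 !centered_shift ltxx.
- by rewrite hq => /not_point_mass_nonconstant hb alpha alpha'; exact: Omega_contraction.
- move=> h [b qb].
  have shiftE (alpha : 'rV[R]_m.+1) : increasing_vec alpha ->
      centered_empirical m.+1 (finite_free_conv m.+1 (poly_of_roots alpha) q) =
      empirical (centered alpha).
    move=> ali; rewrite qb conv_point_mass centered_empirical_poly_of_roots ?centered_shift//.
    by move=> i j ij; rewrite !mxE ltrD2r ali.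
  have := h (poly_of_roots a) (poly_of_roots a').
  rewrite !shiftE// !centered_empirical_poly_of_roots// ltxx => {}h.
  suff : false by []; apply: h.
  + by exists a; split => //; exact: increasing_vec_inj.
  + by exists a'; split => //; exact: increasing_vec_inj.
  + move=> /same_measure_empirical_inj e; apply: aa'; apply: e; exact: centered_increasing.
- rewrite hq => /not_point_mass_nonconstant hb p p' /simple_polyP[u iu ->] /simple_polyP[v iv ->].
  rewrite (OmegaP beta iu).2 (OmegaP beta iv).2.
  have Ou := (OmegaP beta iu).1; have Ov := (OmegaP beta iv).1.
  rewrite !centered_empirical_poly_of_roots//.
  move=> h; apply: lt_W2_empirical; try exact: centered_increasing.
  by apply: Omega_contraction => // e; apply: h; rewrite e.
Qed.
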